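(* Let $\mathcal N$ be a $6$-dimensional complex one-generated nilpotent Novikov algebra. Then $\mathcal N$ is isomorphic to one of the algebras ${\mathcal N}^6_{j}$, $j=01,\ldots,38$ (for some admissible complex values of the parameters, where parameters occur), whose multiplication tables are listed in the context.
   Context: A Novikov algebra is a vector space with a bilinear product satisfying, for all $x,y,z$, $(xy)z=(xz)y$ and $(xy)z-x(yz)=(yx)z-y(xz)$. An algebra is one-generated if it is generated as an algebra by a single element. It is nilpotent if there is some $k$ such that every product of $k$ elements, with any arrangement of brackets, is zero. Each algebra below is the complex algebra with basis $e_1,\dots,e_6$ and the displayed products of basis vectors; all products of basis vectors not displayed are zero. Parameters $\lambda,\mu,\nu,\alpha,\beta$ range over $\mathbb C$ subject to the stated restrictions. - ${\mathcal N}^6_{01}$: $e_1e_1=e_2$, $e_1e_2=e_3$, $e_1e_3=e_5$, $e_1e_4=e_6$, $e_2e_1=e_4$, $e_4e_1=-e_6$. - ${\mathcal N}^6_{02}(\lambda)$: $e_1e_1=e_2$, $e_1e_2=e_3$, $e_1e_3=e_5$, $e_1e_4=\lambda e_6$, $e_2e_1=e_4$, $e_2e_2=e_6$, $e_3e_1=e_6$, $e_4e_1=(2-\lambda)e_6$. - ${\mathcal N}^6_{03}(\lambda,\mu)$: $e_1e_1=e_2$, $e_1e_2=e_3$, $e_1e_3=\lambda e_5+\mu e_6$, $e_1e_4=e_5$, $e_2e_1=e_4$, $e_2e_2=e_6$, $e_3e_1=e_6$, $e_4e_1=-e_5+2e_6$. - ${\mathcal N}^6_{04}$: $e_1e_1=e_2$,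 $e_1e_2=e_5$, $e_1e_3=e_4$, $e_1e_4=2e_6$, $e_2e_1=e_3$, $e_2e_3=-e_6$, $e_3e_1=-e_4$, $e_4e_1=-e_6$. - ${\mathcal N}^6_{05}(\lambda)$: $e_1e_1=e_2$, $e_1e_2=e_3$, $e_1e_3=(2-\lambda)e_4$, $e_1e_4=(3-2\lambda)e_5$, $e_2e_1=\lambda e_3+e_6$, $e_2e_2=\lambda e_4$, $e_2e_3=\lambda(2-\lambda)e_5$, $e_3e_1=\lambda e_4$, $e_3e_2=\lambda e_5$, $e_4e_1=\lambda e_5$. - ${\mathcal N}^6_{06}(\lambda)$: $e_1e_1=e_2$, $e_1e_2=e_3$, $e_1e_3=2e_4$, $e_1e_4=\lambda e_5$, $e_2e_1=e_6$, $e_2e_3=2e_5$, $e_3e_2=-2e_5$, $e_4e_1=e_5$. - ${\mathcal N}^6_{07}$: $e_1e_1=e_2$, $e_1e_2=e_3$, $e_1e_3=2e_4$, $e_1e_4=e_5$, $e_2e_1=e_5$, $e_2e_3=2e_6$, $e_3e_2=-2e_6$, $e_4e_1=e_6$. - ${\mathcal N}^6_{08}$: $e_1e_1=e_2$, $e_1e_2=e_3$, $e_1e_3=2e_4$, $e_1e_4=e_5$, $e_2e_3=2e_6$, $e_3e_2=-2e_6$, $e_4e_1=e_6$. - ${\mathcal N}^6_{09}$: $e_1e_1=e_2$, $e_1e_2=e_3$, $e_1e_3=2e_4+e_6$, $e_1e_4=2e_5$, $e_2e_1=e_4$, $e_2e_2=e_5$, $e_3e_1=e_5$. - ${\mathcal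 N}^6_{10}(\lambda)$: $e_1e_1=e_2$, $e_1e_2=e_3$, $e_1e_3=2e_4+e_6$, $e_1e_4=(2\lambda+1)e_5$, $e_2e_1=e_4$, $e_2e_2=\lambda e_5$, $e_2e_3=-2e_5$, $e_3e_1=\lambda e_5$, $e_3e_2=2e_5$, $e_4e_1=-e_5$. - ${\mathcal N}^6_{11}(\lambda)$: $e_1e_1=e_2$, $e_1e_2=e_3$, $e_1e_3=2e_4+\lambda e_6$, $e_1e_4=e_5+2e_6$, $e_2e_1=e_4$, $e_2e_2=e_6$, $e_2e_3=-2e_5$, $e_3e_1=e_6$, $e_3e_2=2e_5$, $e_4e_1=-e_5$. - ${\mathcal N}^6_{12}$: $e_1e_1=e_2$, $e_1e_2=e_3$, $e_1e_3=e_4-2e_5$, $e_1e_4=e_5$, $e_2e_1=e_3+e_4+e_6$, $e_2e_2=e_4$, $e_2e_3=e_5$, $e_3e_1=e_4$, $e_3e_2=e_5$, $e_4e_1=e_5$. - ${\mathcal N}^6_{13}$: $e_1e_1=e_2$, $e_1e_2=e_4$, $e_1e_3=e_5$, $e_1e_4=e_6$, $e_1e_5=2e_6$, $e_2e_1=e_3$, $e_2e_3=-e_6$, $e_3e_1=-e_5$, $e_5e_1=-e_6$. - ${\mathcal N}^6_{14}(\alpha)$: $e_1e_1=e_2$, $e_1e_2=e_3$, $e_1e_3=e_5+e_6$, $e_1e_4=\alpha e_6$, $e_1e_5=e_6$, $e_2e_1=e_3+e_4$, $e_2e_2=e_5$, $e_2e_3=e_6$, $e_3e_1=e_5$, $e_3e_2=e_6$,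 $e_4e_1=-(\alpha+1)e_6$, $e_5e_1=e_6$. - ${\mathcal N}^6_{15}$: $e_1e_1=e_2$, $e_1e_2=e_3$, $e_1e_3=-e_5+e_6$, $e_1e_5=-3e_6$, $e_2e_1=3e_3+e_4$, $e_2e_2=3e_5$, $e_2e_3=-3e_6$, $e_3e_1=3e_5$, $e_3e_2=3e_6$, $e_4e_1=-3e_6$, $e_5e_1=3e_6$. - ${\mathcal N}^6_{16}(\lambda)$, $\lambda\neq3$: $e_1e_1=e_2$, $e_1e_2=e_3$, $e_1e_3=(2-\lambda)e_5$, $e_1e_4=e_6$, $e_1e_5=(3-2\lambda)e_6$, $e_2e_1=\lambda e_3+e_4$, $e_2e_2=\lambda e_5$, $e_2e_3=\lambda(2-\lambda)e_6$, $e_3e_1=\lambda e_5$, $e_3e_2=\lambda e_6$, $e_4e_1=-e_6$, $e_5e_1=\lambda e_6$. - ${\mathcal N}^6_{17}(\alpha)$: $e_1e_1=e_2$, $e_1e_2=e_3$, $e_1e_3=2e_5$, $e_1e_4=e_6$, $e_1e_5=\alpha e_6$, $e_2e_1=e_4$, $e_2e_3=2e_6$, $e_3e_2=-2e_6$, $e_4e_1=-e_6$, $e_5e_1=e_6$. - ${\mathcal N}^6_{18}(\alpha)$: $e_1e_1=e_2$, $e_1e_2=e_3$, $e_1e_3=2e_5$, $e_1e_4=(\alpha+2)e_6$, $e_1e_5=e_6$, $e_2e_1=e_4$, $e_2e_2=e_6$, $e_3e_1=e_6$, $e_4e_1=-\alpha e_6$. - ${\mathcal N}^6_{19}(\alpha,\beta)$: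 $e_1e_1=e_2$, $e_1e_2=e_3$, $e_1e_3=2e_5$, $e_1e_4=(\alpha+2)e_6$, $e_1e_5=\beta e_6$, $e_2e_1=e_4$, $e_2e_2=e_6$, $e_2e_3=2e_6$, $e_3e_1=e_6$, $e_3e_2=-2e_6$, $e_4e_1=-\alpha e_6$, $e_5e_1=e_6$. - ${\mathcal N}^6_{20}(\lambda,\mu)$: $e_1e_1=e_2$, $e_1e_2=e_3$, $e_1e_3=\lambda e_5$, $e_1e_4=\mu e_5$, $e_1e_5=(2\mu-1)e_6$, $e_2e_1=e_4$, $e_2e_2=e_5$, $e_2e_3=\lambda(2-\mu)e_6$, $e_2e_4=\mu(2-\mu)e_6$, $e_3e_1=e_5$, $e_3e_2=(3-(\lambda+1)(2-\mu))e_6$, $e_4e_1=(2-\mu)e_5$, $e_4e_2=(2-\mu)e_6$, $e_5e_1=(2-\mu)e_6$. - ${\mathcal N}^6_{21}(\lambda,\mu)$, $\mu\neq2$: $e_1e_1=e_2$, $e_1e_2=e_3$, $e_1e_3=\lambda e_5+e_6$, $e_1e_4=\mu e_5$, $e_1e_5=(2\mu-1)e_6$, $e_2e_1=e_4$, $e_2e_2=e_5$, $e_2e_3=\lambda(2-\mu)e_6$, $e_2e_4=\mu(2-\mu)e_6$, $e_3e_1=e_5$, $e_3e_2=(3-(\lambda+1)(2-\mu))e_6$, $e_4e_1=(2-\mu)e_5$, $e_4e_2=(2-\mu)e_6$, $e_5e_1=(2-\mu)e_6$. - ${\mathcal N}^6_{22}(\lambda)$: $e_1e_1=e_2$, $e_1e_2=e_3$,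 $e_1e_3=\lambda e_5$, $e_1e_4=e_5+e_6$, $e_1e_5=e_6$, $e_2e_1=e_4$, $e_2e_2=e_5$, $e_2e_3=\lambda e_6$, $e_2e_4=e_6$, $e_3e_1=e_5$, $e_3e_2=(2-\lambda)e_6$, $e_4e_1=e_5-e_6$, $e_4e_2=e_6$, $e_5e_1=e_6$. - ${\mathcal N}^6_{23}(\nu)$, $\nu\neq0$: $e_1e_1=e_2$, $e_1e_2=e_3$, $e_1e_3=e_5+\nu e_6$, $e_1e_4=e_5+e_6$, $e_1e_5=e_6$, $e_2e_1=e_4$, $e_2e_2=e_5$, $e_2e_3=e_6$, $e_2e_4=e_6$, $e_3e_1=e_5$, $e_3e_2=e_6$, $e_4e_1=e_5-e_6$, $e_4e_2=e_6$, $e_5e_1=e_6$. - ${\mathcal N}^6_{24}(\lambda)$: $e_1e_1=e_2$, $e_1e_2=e_3$, $e_1e_3=\lambda e_5$, $e_1e_4=2e_5+e_6$, $e_1e_5=e_6$, $e_2e_1=e_4$, $e_2e_2=e_5$, $e_3e_1=e_5$, $e_3e_2=e_6$, $e_4e_1=-e_6$. - ${\mathcal N}^6_{25}(\lambda)$, $\lambda\neq0$: $e_1e_1=e_2$, $e_1e_2=e_3$, $e_1e_3=e_5$, $e_1e_4=\lambda e_5$, $e_1e_5=-2e_6$, $e_2e_1=e_4$, $e_2e_3=e_6$, $e_2e_4=\lambda e_6$, $e_3e_2=-e_6$, $e_4e_1=-\lambda e_5$, $e_5e_1=e_6$. - ${\mathcal N}^6_{26}(\lambda)$, $\lambda\neq0$: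 $e_1e_1=e_2$, $e_1e_2=e_3$, $e_1e_3=e_5$, $e_1e_4=\lambda e_5+e_6$, $e_1e_5=-2e_6$, $e_2e_1=e_4$, $e_2e_3=e_6$, $e_2e_4=\lambda e_6$, $e_3e_2=-e_6$, $e_4e_1=-\lambda e_5-e_6$, $e_5e_1=e_6$. - ${\mathcal N}^6_{27}$: $e_1e_1=e_2$, $e_1e_3=e_4$, $e_1e_4=2e_5$, $e_1e_5=3e_6$, $e_2e_1=e_3$, $e_2e_3=-e_5$, $e_2e_4=-2e_6$, $e_3e_1=-e_4$, $e_3e_3=e_6$, $e_4e_1=-e_5$, $e_5e_1=-e_6$. - ${\mathcal N}^6_{28}$: $e_1e_1=e_2$, $e_1e_2=e_5$, $e_1e_3=e_4$, $e_1e_4=2e_5$, $e_1e_5=3e_6$, $e_2e_1=e_3$, $e_2e_2=-e_6$, $e_2e_3=-e_5$, $e_2e_4=-2e_6$, $e_3e_1=-e_4-2e_6$, $e_3e_3=e_6$, $e_4e_1=-e_5$, $e_5e_1=-e_6$. - ${\mathcal N}^6_{29}(\lambda)$: $e_1e_1=e_2$, $e_1e_2=e_3$, $e_1e_3=(2-\lambda)e_4$, $e_1e_4=(3-2\lambda)e_5$, $e_1e_5=(4-3\lambda)e_6$, $e_2e_1=\lambda e_3$, $e_2e_2=\lambda e_4$, $e_2e_3=\lambda(2-\lambda)e_5$, $e_2e_4=\lambda(3-2\lambda)e_6$, $e_3e_1=\lambda e_4$, $e_3e_2=\lambda e_5$, $e_3e_3=\lambda(2-\lambda)e_6$, $e_4e_1=\lambda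 e_5$, $e_4e_2=\lambda e_6$, $e_5e_1=\lambda e_6$. - ${\mathcal N}^6_{30}$: $e_1e_1=e_2$, $e_1e_2=e_3$, $e_1e_4=-e_5$, $e_1e_5=-2e_6$, $e_2e_1=2e_3+e_6$, $e_2e_2=2e_4$, $e_2e_4=-2e_6$, $e_3e_1=2e_4$, $e_3e_2=2e_5$, $e_4e_1=2e_5$, $e_4e_2=2e_6$, $e_5e_1=2e_6$. - ${\mathcal N}^6_{31}$: $e_1e_1=e_2$, $e_1e_2=e_3$, $e_1e_3=2e_4$, $e_1e_4=3e_5$, $e_1e_5=e_6$, $e_2e_3=2e_6$, $e_3e_2=-2e_6$, $e_4e_1=e_6$. - ${\mathcal N}^6_{32}$: $e_1e_1=e_2$, $e_1e_2=e_3$, $e_1e_3=2e_4$, $e_1e_4=3e_5$, $e_1e_5=e_6$, $e_2e_1=e_6$. - ${\mathcal N}^6_{33}$: $e_1e_1=e_2$, $e_1e_2=e_3$, $e_1e_3=e_4$, $e_1e_4=e_5$, $e_1e_5=e_6$, $e_2e_1=e_3+e_6$, $e_2e_2=e_4$, $e_2e_3=e_5$, $e_2e_4=e_6$, $e_3e_1=e_4$, $e_3e_2=e_5$, $e_3e_3=e_6$, $e_4e_1=e_5$, $e_4e_2=e_6$, $e_5e_1=e_6$. - ${\mathcal N}^6_{34}(\lambda)$: $e_1e_1=e_2$, $e_1e_2=e_3$, $e_1e_3=e_4$, $e_1e_4=e_5$, $e_1e_5=2e_6$, $e_2e_1=e_5+\lambda e_6$, $e_2e_2=e_6$, $e_3e_1=e_6$.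 - ${\mathcal N}^6_{35}(\lambda)$, $\lambda\neq0$: $e_1e_1=e_2$, $e_1e_2=e_3$, $e_1e_3=e_4$, $e_1e_4=e_5$, $e_1e_5=2e_6$, $e_2e_1=e_5$, $e_2e_2=e_6$, $e_2e_3=\lambda e_6$, $e_3e_1=e_6$, $e_3e_2=-\lambda e_6$, $e_4e_1=\lambda e_6$. - ${\mathcal N}^6_{36}$: $e_1e_1=e_2$, $e_1e_2=e_3$, $e_1e_3=e_4-2e_6$, $e_1e_4=e_5$, $e_1e_5=e_6$, $e_2e_1=e_3+e_5$, $e_2e_2=e_4$, $e_2e_3=e_5$, $e_2e_4=e_6$, $e_3e_1=e_4$, $e_3e_2=e_5$, $e_3e_3=e_6$, $e_4e_1=e_5$, $e_4e_2=e_6$, $e_5e_1=e_6$. - ${\mathcal N}^6_{37}(\lambda,\mu)$: $e_1e_1=e_2$, $e_1e_2=e_3$, $e_1e_3=2e_4+\lambda e_5$, $e_1e_4=2e_5+\mu e_6$, $e_1e_5=e_6$, $e_2e_1=e_4$, $e_2e_2=e_5$, $e_2e_3=-2\mu e_6$, $e_3e_1=e_5$, $e_3e_2=(1+2\mu)e_6$, $e_4e_1=-\mu e_6$. - ${\mathcal N}^6_{38}(\lambda)$: $e_1e_1=e_2$, $e_1e_2=e_3$, $e_1e_3=e_4-2e_5+(1-2\lambda)e_6$, $e_1e_4=e_5-2e_6$, $e_1e_5=e_6$, $e_2e_1=e_3+e_4+\lambda e_5$, $e_2e_2=e_4$, $e_2e_3=e_5-e_6$, $e_2e_4=e_6$,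 $e_3e_1=e_4$, $e_3e_2=e_5$, $e_3e_3=e_6$, $e_4e_1=e_5+e_6$, $e_4e_2=e_6$, $e_5e_1=e_6$. *)

(* Defs.v *)
From mathcomp Require Import all_boot all_order all_algebra.
From mathcomp Require Import reals complex.

Set Implicit Arguments.
Unset Strict Implicit.
Unset Printing Implicit Defensive.

Import GRing.Theory.
Local Open Scope ring_scope.

(* A (not necessarily associative, not necessarily unital) finite-dimensional *)
(* algebra is a vectType together with a bilinear product mul : V -> V -> V.  *)
Section Algebra.
Variables (F : fieldType) (V : vectType F) (mul : V -> V -> V).
Local Notation "x · y" := (mul x y) (at level 40, left associativity).

Definition novikov : Prop :=
  (forall x y z, (x · y) · z = (x · z) · y) /\
  (forall x y z, (x · y) · z - x · (y · z) = (y · x) · z - y · (x · z)).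

Definition subalgebra (U : {vspace V}) : Prop :=
  forall x y, x \in U -> y \in U -> x · y \in U.

Definition one_generated : Prop :=
  exists a, forall U, subalgebra U -> a \in U -> U = fullv.

(* nprod k x: x is the value of some bracketed product of k elements of V. *)
Inductive nprod : nat -> V -> Prop :=
| Nprod1 x : nprod 1%N x
| NprodM k l x y of nprod k x & nprod l y : nprod (k + l)%N (x · y).

(* k > 0 is needed because nprod 0 is empty. *)
Definition nilpotent : Prop :=
  exists2 k, (0 < k)%N & forall x, nprod k x -> x = 0.

End Algebra.

Definition isomorphic (F : fieldType) (V W : vectType F)
    (mulV : V -> V -> V) (mulW : W -> W -> W) : Prop :=
  exists f : {linear V -> W},
    bijective f /\ forall x y, f (mulV x y) = mulW (f x) (f y).

Section Tables.
Variable F : fieldType.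

(* The standard basis of F^6, indexed from 1 to 6. *)
Definition e (i : nat) : 'rV[F]_6 := delta_mx 0 (inord i.-1).

(* An entry (i, j, v) of a multiplication table means e_i e_j = v; a pair     *)
(* (i, j) occurs at most once in a table, and e_i e_j = 0 if it does not.     *)
Definition table := seq (nat * nat * 'rV[F]_6).

Definition table_mul (t : table) (x y : 'rV[F]_6) : 'rV[F]_6 :=
  \sum_(p <- t) (x 0 (inord p.1.1.-1) * y 0 (inord p.1.2.-1)) *: p.2.

Local Notation "i ** j |-> v" := (i%N, j%N, v)
  (at level 70, j at next level, v at next level).

Definition N01 : table :=
  [:: 1 ** 1 |-> e 2; 1 ** 2 |-> e 3; 1 ** 3 |-> e 5; 1 ** 4 |-> e 6;
      2 ** 1 |-> e 4; 4 ** 1 |-> - e 6].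

Definition N02 (lam : F) : table :=
  [:: 1 ** 1 |-> e 2; 1 ** 2 |-> e 3; 1 ** 3 |-> e 5; 1 ** 4 |-> lam *: e 6;
      2 ** 1 |-> e 4; 2 ** 2 |-> e 6; 3 ** 1 |-> e 6;
      4 ** 1 |-> (2 - lam) *: e 6].

Definition N03 (lam mu : F) : table :=
  [:: 1 ** 1 |-> e 2; 1 ** 2 |-> e 3; 1 ** 3 |-> lam *: e 5 + mu *: e 6;
      1 ** 4 |-> e 5; 2 ** 1 |-> e 4; 2 ** 2 |-> e 6; 3 ** 1 |-> e 6;
      4 ** 1 |-> - e 5 + 2 *: e 6].

Definition N04 : table :=
  [:: 1 ** 1 |-> e 2; 1 ** 2 |-> e 5; 1 ** 3 |-> e 4; 1 ** 4 |-> 2 *: e 6;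
      2 ** 1 |-> e 3; 2 ** 3 |-> - e 6; 3 ** 1 |-> - e 4; 4 ** 1 |-> - e 6].

Definition N05 (lam : F) : table :=
  [:: 1 ** 1 |-> e 2; 1 ** 2 |-> e 3; 1 ** 3 |-> (2 - lam) *: e 4;
      1 ** 4 |-> (3 - 2 * lam) *: e 5; 2 ** 1 |-> lam *: e 3 + e 6;
      2 ** 2 |-> lam *: e 4; 2 ** 3 |-> (lam * (2 - lam)) *: e 5;
      3 ** 1 |-> lam *: e 4; 3 ** 2 |-> lam *: e 5; 4 ** 1 |-> lam *: e 5].

Definition N06 (lam : F) : table :=
  [:: 1 ** 1 |-> e 2; 1 ** 2 |-> e 3; 1 ** 3 |-> 2 *: e 4;
      1 ** 4 |-> lam *: e 5; 2 ** 1 |-> e 6; 2 ** 3 |-> 2 *: e 5;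
      3 ** 2 |-> - 2 *: e 5; 4 ** 1 |-> e 5].

Definition N07 : table :=
  [:: 1 ** 1 |-> e 2; 1 ** 2 |-> e 3; 1 ** 3 |-> 2 *: e 4; 1 ** 4 |-> e 5;
      2 ** 1 |-> e 5; 2 ** 3 |-> 2 *: e 6; 3 ** 2 |-> - 2 *: e 6;
      4 ** 1 |-> e 6].

Definition N08 : table :=
  [:: 1 ** 1 |-> e 2; 1 ** 2 |-> e 3; 1 ** 3 |-> 2 *: e 4; 1 ** 4 |-> e 5;
      2 ** 3 |-> 2 *: e 6; 3 ** 2 |-> - 2 *: e 6; 4 ** 1 |-> e 6].

Definition N09 : table :=
  [:: 1 ** 1 |-> e 2; 1 ** 2 |-> e 3; 1 ** 3 |-> 2 *: e 4 + e 6;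
      1 ** 4 |-> 2 *: e 5; 2 ** 1 |-> e 4; 2 ** 2 |-> e 5; 3 ** 1 |-> e 5].

Definition N10 (lam : F) : table :=
  [:: 1 ** 1 |-> e 2; 1 ** 2 |-> e 3; 1 ** 3 |-> 2 *: e 4 + e 6;
      1 ** 4 |-> (2 * lam + 1) *: e 5; 2 ** 1 |-> e 4;
      2 ** 2 |-> lam *: e 5; 2 ** 3 |-> - 2 *: e 5; 3 ** 1 |-> lam *: e 5;
      3 ** 2 |-> 2 *: e 5; 4 ** 1 |-> - e 5].

Definition N11 (lam : F) : table :=
  [:: 1 ** 1 |-> e 2; 1 ** 2 |-> e 3; 1 ** 3 |-> 2 *: e 4 + lam *: e 6;
      1 ** 4 |-> e 5 + 2 *: e 6; 2 ** 1 |-> e 4; 2 ** 2 |-> e 6;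
      2 ** 3 |-> - 2 *: e 5; 3 ** 1 |-> e 6; 3 ** 2 |-> 2 *: e 5;
      4 ** 1 |-> - e 5].

Definition N12 : table :=
  [:: 1 ** 1 |-> e 2; 1 ** 2 |-> e 3; 1 ** 3 |-> e 4 - 2 *: e 5;
      1 ** 4 |-> e 5; 2 ** 1 |-> e 3 + e 4 + e 6; 2 ** 2 |-> e 4;
      2 ** 3 |-> e 5; 3 ** 1 |-> e 4; 3 ** 2 |-> e 5; 4 ** 1 |-> e 5].

Definition N13 : table :=
  [:: 1 ** 1 |-> e 2; 1 ** 2 |-> e 4; 1 ** 3 |-> e 5; 1 ** 4 |-> e 6;
      1 ** 5 |-> 2 *: e 6; 2 ** 1 |-> e 3; 2 ** 3 |-> - e 6;
      3 ** 1 |-> - e 5; 5 ** 1 |-> - e 6].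

Definition N14 (alp : F) : table :=
  [:: 1 ** 1 |-> e 2; 1 ** 2 |-> e 3; 1 ** 3 |-> e 5 + e 6;
      1 ** 4 |-> alp *: e 6; 1 ** 5 |-> e 6; 2 ** 1 |-> e 3 + e 4;
      2 ** 2 |-> e 5; 2 ** 3 |-> e 6; 3 ** 1 |-> e 5; 3 ** 2 |-> e 6;
      4 ** 1 |-> - (alp + 1) *: e 6; 5 ** 1 |-> e 6].

Definition N15 : table :=
  [:: 1 ** 1 |-> e 2; 1 ** 2 |-> e 3; 1 ** 3 |-> - e 5 + e 6;
      1 ** 5 |-> - 3 *: e 6; 2 ** 1 |-> 3 *: e 3 + e 4; 2 ** 2 |-> 3 *: e 5;
      2 ** 3 |-> - 3 *: e 6; 3 ** 1 |-> 3 *: e 5; 3 ** 2 |-> 3 *: e 6;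
      4 ** 1 |-> - 3 *: e 6; 5 ** 1 |-> 3 *: e 6].

Definition N16 (lam : F) : table :=
  [:: 1 ** 1 |-> e 2; 1 ** 2 |-> e 3; 1 ** 3 |-> (2 - lam) *: e 5;
      1 ** 4 |-> e 6; 1 ** 5 |-> (3 - 2 * lam) *: e 6;
      2 ** 1 |-> lam *: e 3 + e 4; 2 ** 2 |-> lam *: e 5;
      2 ** 3 |-> (lam * (2 - lam)) *: e 6; 3 ** 1 |-> lam *: e 5;
      3 ** 2 |-> lam *: e 6; 4 ** 1 |-> - e 6; 5 ** 1 |-> lam *: e 6].

Definition N17 (alp : F) : table :=
  [:: 1 ** 1 |-> e 2; 1 ** 2 |-> e 3; 1 ** 3 |-> 2 *: e 5; 1 ** 4 |-> e 6;
      1 ** 5 |-> alp *: e 6; 2 ** 1 |-> e 4; 2 ** 3 |-> 2 *: e 6;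
      3 ** 2 |-> - 2 *: e 6; 4 ** 1 |-> - e 6; 5 ** 1 |-> e 6].

Definition N18 (alp : F) : table :=
  [:: 1 ** 1 |-> e 2; 1 ** 2 |-> e 3; 1 ** 3 |-> 2 *: e 5;
      1 ** 4 |-> (alp + 2) *: e 6; 1 ** 5 |-> e 6; 2 ** 1 |-> e 4;
      2 ** 2 |-> e 6; 3 ** 1 |-> e 6; 4 ** 1 |-> - alp *: e 6].

Definition N19 (alp bet : F) : table :=
  [:: 1 ** 1 |-> e 2; 1 ** 2 |-> e 3; 1 ** 3 |-> 2 *: e 5;
      1 ** 4 |-> (alp + 2) *: e 6; 1 ** 5 |-> bet *: e 6; 2 ** 1 |-> e 4;
      2 ** 2 |-> e 6; 2 ** 3 |-> 2 *: e 6; 3 ** 1 |-> e 6;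
      3 ** 2 |-> - 2 *: e 6; 4 ** 1 |-> - alp *: e 6; 5 ** 1 |-> e 6].

Definition N20 (lam mu : F) : table :=
  [:: 1 ** 1 |-> e 2; 1 ** 2 |-> e 3; 1 ** 3 |-> lam *: e 5;
      1 ** 4 |-> mu *: e 5; 1 ** 5 |-> (2 * mu - 1) *: e 6; 2 ** 1 |-> e 4;
      2 ** 2 |-> e 5; 2 ** 3 |-> (lam * (2 - mu)) *: e 6;
      2 ** 4 |-> (mu * (2 - mu)) *: e 6; 3 ** 1 |-> e 5;
      3 ** 2 |-> (3 - (lam + 1) * (2 - mu)) *: e 6;
      4 ** 1 |-> (2 - mu) *: e 5; 4 ** 2 |-> (2 - mu) *: e 6;
      5 ** 1 |-> (2 - mu) *: e 6].

Definition N21 (lam mu : F) : table :=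
  [:: 1 ** 1 |-> e 2; 1 ** 2 |-> e 3; 1 ** 3 |-> lam *: e 5 + e 6;
      1 ** 4 |-> mu *: e 5; 1 ** 5 |-> (2 * mu - 1) *: e 6; 2 ** 1 |-> e 4;
      2 ** 2 |-> e 5; 2 ** 3 |-> (lam * (2 - mu)) *: e 6;
      2 ** 4 |-> (mu * (2 - mu)) *: e 6; 3 ** 1 |-> e 5;
      3 ** 2 |-> (3 - (lam + 1) * (2 - mu)) *: e 6;
      4 ** 1 |-> (2 - mu) *: e 5; 4 ** 2 |-> (2 - mu) *: e 6;
      5 ** 1 |-> (2 - mu) *: e 6].

Definition N22 (lam : F) : table :=
  [:: 1 ** 1 |-> e 2; 1 ** 2 |-> e 3; 1 ** 3 |-> lam *: e 5;
      1 ** 4 |-> e 5 + e 6; 1 ** 5 |-> e 6; 2 ** 1 |-> e 4; 2 ** 2 |-> e 5;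
      2 ** 3 |-> lam *: e 6; 2 ** 4 |-> e 6; 3 ** 1 |-> e 5;
      3 ** 2 |-> (2 - lam) *: e 6; 4 ** 1 |-> e 5 - e 6; 4 ** 2 |-> e 6;
      5 ** 1 |-> e 6].

Definition N23 (nu : F) : table :=
  [:: 1 ** 1 |-> e 2; 1 ** 2 |-> e 3; 1 ** 3 |-> e 5 + nu *: e 6;
      1 ** 4 |-> e 5 + e 6; 1 ** 5 |-> e 6; 2 ** 1 |-> e 4; 2 ** 2 |-> e 5;
      2 ** 3 |-> e 6; 2 ** 4 |-> e 6; 3 ** 1 |-> e 5; 3 ** 2 |-> e 6;
      4 ** 1 |-> e 5 - e 6; 4 ** 2 |-> e 6; 5 ** 1 |-> e 6].

Definition N24 (lam : F) : table :=
  [:: 1 ** 1 |-> e 2; 1 ** 2 |-> e 3; 1 ** 3 |-> lam *: e 5;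
      1 ** 4 |-> 2 *: e 5 + e 6; 1 ** 5 |-> e 6; 2 ** 1 |-> e 4;
      2 ** 2 |-> e 5; 3 ** 1 |-> e 5; 3 ** 2 |-> e 6; 4 ** 1 |-> - e 6].

Definition N25 (lam : F) : table :=
  [:: 1 ** 1 |-> e 2; 1 ** 2 |-> e 3; 1 ** 3 |-> e 5; 1 ** 4 |-> lam *: e 5;
      1 ** 5 |-> - 2 *: e 6; 2 ** 1 |-> e 4; 2 ** 3 |-> e 6;
      2 ** 4 |-> lam *: e 6; 3 ** 2 |-> - e 6; 4 ** 1 |-> - lam *: e 5;
      5 ** 1 |-> e 6].

Definition N26 (lam : F) : table :=
  [:: 1 ** 1 |-> e 2; 1 ** 2 |-> e 3; 1 ** 3 |-> e 5;
      1 ** 4 |-> lam *: e 5 + e 6; 1 ** 5 |-> - 2 *: e 6; 2 ** 1 |-> e 4;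
      2 ** 3 |-> e 6; 2 ** 4 |-> lam *: e 6; 3 ** 2 |-> - e 6;
      4 ** 1 |-> - lam *: e 5 - e 6; 5 ** 1 |-> e 6].

Definition N27 : table :=
  [:: 1 ** 1 |-> e 2; 1 ** 3 |-> e 4; 1 ** 4 |-> 2 *: e 5;
      1 ** 5 |-> 3 *: e 6; 2 ** 1 |-> e 3; 2 ** 3 |-> - e 5;
      2 ** 4 |-> - 2 *: e 6; 3 ** 1 |-> - e 4; 3 ** 3 |-> e 6;
      4 ** 1 |-> - e 5; 5 ** 1 |-> - e 6].

Definition N28 : table :=
  [:: 1 ** 1 |-> e 2; 1 ** 2 |-> e 5; 1 ** 3 |-> e 4; 1 ** 4 |-> 2 *: e 5;
      1 ** 5 |-> 3 *: e 6; 2 ** 1 |-> e 3; 2 ** 2 |-> - e 6;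
      2 ** 3 |-> - e 5; 2 ** 4 |-> - 2 *: e 6; 3 ** 1 |-> - e 4 - 2 *: e 6;
      3 ** 3 |-> e 6; 4 ** 1 |-> - e 5; 5 ** 1 |-> - e 6].

Definition N29 (lam : F) : table :=
  [:: 1 ** 1 |-> e 2; 1 ** 2 |-> e 3; 1 ** 3 |-> (2 - lam) *: e 4;
      1 ** 4 |-> (3 - 2 * lam) *: e 5; 1 ** 5 |-> (4 - 3 * lam) *: e 6;
      2 ** 1 |-> lam *: e 3; 2 ** 2 |-> lam *: e 4;
      2 ** 3 |-> (lam * (2 - lam)) *: e 5;
      2 ** 4 |-> (lam * (3 - 2 * lam)) *: e 6; 3 ** 1 |-> lam *: e 4;
      3 ** 2 |-> lam *: e 5; 3 ** 3 |-> (lam * (2 - lam)) *: e 6;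
      4 ** 1 |-> lam *: e 5; 4 ** 2 |-> lam *: e 6; 5 ** 1 |-> lam *: e 6].

Definition N30 : table :=
  [:: 1 ** 1 |-> e 2; 1 ** 2 |-> e 3; 1 ** 4 |-> - e 5;
      1 ** 5 |-> - 2 *: e 6; 2 ** 1 |-> 2 *: e 3 + e 6; 2 ** 2 |-> 2 *: e 4;
      2 ** 4 |-> - 2 *: e 6; 3 ** 1 |-> 2 *: e 4; 3 ** 2 |-> 2 *: e 5;
      4 ** 1 |-> 2 *: e 5; 4 ** 2 |-> 2 *: e 6; 5 ** 1 |-> 2 *: e 6].

Definition N31 : table :=
  [:: 1 ** 1 |-> e 2; 1 ** 2 |-> e 3; 1 ** 3 |-> 2 *: e 4;
      1 ** 4 |-> 3 *: e 5; 1 ** 5 |-> e 6; 2 ** 3 |-> 2 *: e 6;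
      3 ** 2 |-> - 2 *: e 6; 4 ** 1 |-> e 6].

Definition N32 : table :=
  [:: 1 ** 1 |-> e 2; 1 ** 2 |-> e 3; 1 ** 3 |-> 2 *: e 4;
      1 ** 4 |-> 3 *: e 5; 1 ** 5 |-> e 6; 2 ** 1 |-> e 6].

Definition N33 : table :=
  [:: 1 ** 1 |-> e 2; 1 ** 2 |-> e 3; 1 ** 3 |-> e 4; 1 ** 4 |-> e 5;
      1 ** 5 |-> e 6; 2 ** 1 |-> e 3 + e 6; 2 ** 2 |-> e 4; 2 ** 3 |-> e 5;
      2 ** 4 |-> e 6; 3 ** 1 |-> e 4; 3 ** 2 |-> e 5; 3 ** 3 |-> e 6;
      4 ** 1 |-> e 5; 4 ** 2 |-> e 6; 5 ** 1 |-> e 6].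

Definition N34 (lam : F) : table :=
  [:: 1 ** 1 |-> e 2; 1 ** 2 |-> e 3; 1 ** 3 |-> e 4; 1 ** 4 |-> e 5;
      1 ** 5 |-> 2 *: e 6; 2 ** 1 |-> e 5 + lam *: e 6; 2 ** 2 |-> e 6;
      3 ** 1 |-> e 6].

Definition N35 (lam : F) : table :=
  [:: 1 ** 1 |-> e 2; 1 ** 2 |-> e 3; 1 ** 3 |-> e 4; 1 ** 4 |-> e 5;
      1 ** 5 |-> 2 *: e 6; 2 ** 1 |-> e 5; 2 ** 2 |-> e 6;
      2 ** 3 |-> lam *: e 6; 3 ** 1 |-> e 6; 3 ** 2 |-> - lam *: e 6;
      4 ** 1 |-> lam *: e 6].

Definition N36 : table :=
  [:: 1 ** 1 |-> e 2; 1 ** 2 |-> e 3; 1 ** 3 |-> e 4 - 2 *: e 6;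
      1 ** 4 |-> e 5; 1 ** 5 |-> e 6; 2 ** 1 |-> e 3 + e 5; 2 ** 2 |-> e 4;
      2 ** 3 |-> e 5; 2 ** 4 |-> e 6; 3 ** 1 |-> e 4; 3 ** 2 |-> e 5;
      3 ** 3 |-> e 6; 4 ** 1 |-> e 5; 4 ** 2 |-> e 6; 5 ** 1 |-> e 6].

Definition N37 (lam mu : F) : table :=
  [:: 1 ** 1 |-> e 2; 1 ** 2 |-> e 3; 1 ** 3 |-> 2 *: e 4 + lam *: e 5;
      1 ** 4 |-> 2 *: e 5 + mu *: e 6; 1 ** 5 |-> e 6; 2 ** 1 |-> e 4;
      2 ** 2 |-> e 5; 2 ** 3 |-> - (2 * mu) *: e 6; 3 ** 1 |-> e 5;
      3 ** 2 |-> (1 + 2 * mu) *: e 6; 4 ** 1 |-> - mu *: e 6].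

Definition N38 (lam : F) : table :=
  [:: 1 ** 1 |-> e 2; 1 ** 2 |-> e 3;
      1 ** 3 |-> e 4 - 2 *: e 5 + (1 - 2 * lam) *: e 6;
      1 ** 4 |-> e 5 - 2 *: e 6; 1 ** 5 |-> e 6;
      2 ** 1 |-> e 3 + e 4 + lam *: e 5; 2 ** 2 |-> e 4;
      2 ** 3 |-> e 5 - e 6; 2 ** 4 |-> e 6; 3 ** 1 |-> e 4; 3 ** 2 |-> e 5;
      3 ** 3 |-> e 6; 4 ** 1 |-> e 5 + e 6; 4 ** 2 |-> e 6; 5 ** 1 |-> e 6].

Inductive listed : table -> Prop :=
| Listed01 : listed N01
| Listed02 lam : listed (N02 lam)
| Listed03 lam mu : listed (N03 lam mu)
| Listed04 : listed N04
| Listed05 lam : listed (N05 lam)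
| Listed06 lam : listed (N06 lam)
| Listed07 : listed N07
| Listed08 : listed N08
| Listed09 : listed N09
| Listed10 lam : listed (N10 lam)
| Listed11 lam : listed (N11 lam)
| Listed12 : listed N12
| Listed13 : listed N13
| Listed14 alp : listed (N14 alp)
| Listed15 : listed N15
| Listed16 (lam : F) of lam != 3 : listed (N16 lam)
| Listed17 alp : listed (N17 alp)
| Listed18 alp : listed (N18 alp)
| Listed19 alp bet : listed (N19 alp bet)
| Listed20 lam mu : listed (N20 lam mu)
| Listed21 (lam mu : F) of mu != 2 : listed (N21 lam mu)
| Listed22 lam : listed (N22 lam)
| Listed23 (nu : F) of nu != 0 : listed (N23 nu)
| Listed24 lam : listed (N24 lam)
| Listed25 (lam : F) of lam != 0 : listed (N25 lam)
| Listed26 (lam : F) of lam != 0 : listed (N26 lam)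
| Listed27 : listed N27
| Listed28 : listed N28
| Listed29 lam : listed (N29 lam)
| Listed30 : listed N30
| Listed31 : listed N31
| Listed32 : listed N32
| Listed33 : listed N33
| Listed34 lam : listed (N34 lam)
| Listed35 (lam : F) of lam != 0 : listed (N35 lam)
| Listed36 : listed N36
| Listed37 lam mu : listed (N37 lam mu)
| Listed38 lam : listed (N38 lam).

End Tables.

(* Main.v *)
(* Let V be generated by a, and let L and R be the left and right             *)
(* multiplications by a. In a Novikov algebra L_{xy} = R_y L_x and            *)
(* R_{xy} = R_y R_x - R_y L_x + L_x R_y, so that the whole product is         *)
(* determined by L and R, and the power V^{k+1} is L V^k + R V^k modulo       *)
(* V^{k+2}. Moreover [R, [R, L]] = 0. In dimension 6 these relations leave    *)
(* (1,1,2,2), (1,1,2,1,1), (1,1,1,1,2) and (1,1,1,1,1,1) as the possible      *)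
(* dimensions of the quotients V^k / V^{k+1}: families A, B, D and E-I below, *)
(* separated by whether a(aa) and (aa)a are independent modulo V^4. In each   *)
(* family the product is given by a table with a few parameters, most of      *)
(* which are removed by replacing a by c a + s aa + t a(aa) + ...; the        *)
(* remaining values are those of the list. Vectors starting with a generator  *)
(* and multiplying according to a table span a subalgebra, hence V, so six of *)
(* them need not be shown to be independent.                                  *)

From HB Require Import structures.
Require Import Defs.
From mathcomp Require Import all_boot all_order all_algebra.
From mathcomp Require Import reals complex ring.

Set Implicit Arguments.
Unset Strict Implicit.
Unset Printing Implicit Defensive.

Import Order.TTheory GRing.Theory Num.Theory.
Local Open Scope ring_scope.

(** Write x3 = a(aa), x4 = (aa)a, A = a x3, B = a x4, C = x3 a. Nilpotency makes the dimensions of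
    the V^k strictly decrease until they vanish, and V/V^2 and V^2/V^3 are lines, so dim V^3 = 4
    ([dims]). Little freedom is left in higher degrees because of x4 a = 2C - B ([x4a]), the degree
    5 relation [deg5_rel], and [heisenberg] at x3 or x4. [classified_of_generator] distinguishes
    whether x3 lies in V^4, x4 is a multiple of x3 modulo V^4, or neither. In each case six words in
    a are chosen and their products with a are expressed through them; by [framed_words] this
    determines the whole multiplication table.

    An element c a + y with c nonzero and y in V^2 is again a generator ([generates_shift]). Passing
    from a to c a multiplies the parameters of the table by powers of c; adding a multiple of a
    higher basis vector changes some of them by terms whose coefficients depend on the others. The
    [classify_] lemmas normalise the parameters in this way, with roots taken in an algebraically
    closed field. Where such a coefficient vanishes (l = 0, 1, 2 in family E, m = 1, 2 in family B)
    a parameter may survive, which calls for separate entries of the list.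

    Finally, [table_isomorphic] turns a family of vectors multiplying by a listed table, the first
    of which generates V, into an isomorphism. *)

Local Notation "i ** j |-> x" := (i%N, j%N, x)
  (at level 70, j at next level, x at next level).
Local Notation "c @ k" := (k%N, c) (at level 50, no associativity).

(** * Tables and coordinate vectors as computable lists *)

Section SparseTables.
Variable F : fieldType.

(* A vector \sum_k c_k e_k is represented by the list of the pairs (k, c_k),  *)
(* and a table by the list of the triples (i, j, e_i e_j).                    *)
Definition svec := seq (nat * F).
Definition stable := seq (nat * nat * svec).

Fixpoint sscale (c : F) (x : svec) : svec :=
  if x is (i, d) :: x' then (i, c * d) :: sscale c x' else [::].

Fixpoint sapp (x y : svec) : svec :=
  if x is p :: x' then p :: sapp x' y else y.

Fixpoint scoef (k : nat) (x : svec) : F :=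
  if x is (i, c) :: x' then
    if eqn i k then c + scoef k x' else scoef k x'
  else 0.

Fixpoint entry (t : stable) (i j : nat) : svec :=
  if t is (k, l, x) :: t' then
    if eqn k i then if eqn l j then sapp x (entry t' i j)
      else entry t' i j else entry t' i j
  else [::].

Fixpoint sbind (g : nat -> svec) (x : svec) : svec :=
  if x is (i, c) :: x' then sapp (sscale c (g i)) (sbind g x') else [::].

Definition smul (t : stable) (x y : svec) : svec :=
  sbind (fun i => sbind (fun j => entry t i j) y) x.

Definition mrow (m : seq svec) (i : nat) : svec := nth [::] m i.-1.

Definition indices : seq nat := [:: 1; 2; 3; 4; 5; 6]%N.

(** A recursive conjunction, so that [cbv] reduces statements about tables to finitely many explicit
    field identities. *)
Fixpoint forall_in (s : seq nat) (Q : nat -> Prop) : Prop :=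
  if s is i :: s' then Q i /\ forall_in s' Q else True.

Definition seqv (x y : svec) : Prop :=
  forall_in indices (fun k => scoef k x = scoef k y).

Definition swf (x : svec) : bool := all (fun p => p.1 \in indices) x.

(* The rows of m are the coordinates of six vectors of the algebra with table *)
(* t, which multiply according to t'.                                         *)
Definition intertwines (t : stable) (m : seq svec) (t' : stable) : Prop :=
  forall_in indices (fun i => forall_in indices (fun j =>
    seqv (smul t (mrow m i) (mrow m j)) (sbind (mrow m) (entry t' i j)))).

Definition stwf (t : stable) : bool :=
  all (fun p => [&& p.1.1 \in indices, p.1.2 \in indices & swf p.2]) t.

(** Follows the syntax of a row, so that its coordinates are read off without evaluating [delta_mx]
    or [inord]. *)
Inductive row_expr : 'rV[F]_6 -> svec -> Prop :=
| RowE k : row_expr (e F k) [:: (k, 1)]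
| RowD r x s y of row_expr r x & row_expr s y : row_expr (r + s) (sapp x y)
| RowZ c r x of row_expr r x : row_expr (c *: r) (sscale c x)
| RowN r x of row_expr r x : row_expr (- r) (sscale (-1) x).

Inductive encodes : table F -> stable -> Prop :=
| EncNil : encodes [::] [::]
| EncCons i j r x t s of row_expr r x & encodes t s :
    encodes ((i, j, r) :: t) ((i, j, x) :: s).

Lemma forall_in_iff s (Q : nat -> Prop) :
  forall_in s Q <-> (forall i, i \in s -> Q i).
Proof.
elim: s => [|i s IH] //=; split.
  move=> [Qi Qs] j; rewrite inE => /orP[/eqP->//|js]; exact: (proj1 IH Qs).
move=> h; split; first by apply: h; rewrite inE eqxx.
by apply/IH => j js; apply: h; rewrite inE js orbT.
Qed.

End SparseTables.

Section Eval.
Variables (F : fieldType) (V : vectType F).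
Implicit Types (v : nat -> V) (x y : svec F).

Definition eval v x : V := \sum_(p <- x) p.2 *: v p.1.

Lemma eval_nil v : eval v [::] = 0.
Proof. exact: big_nil. Qed.

Lemma eval_cons v i c x : eval v ((i, c) :: x) = c *: v i + eval v x.
Proof. exact: big_cons. Qed.

Lemma eval_app v x y : eval v (sapp x y) = eval v x + eval v y.
Proof.
elim: x => [|[i c] x IH] /=; first by rewrite eval_nil add0r.
by rewrite !eval_cons IH addrA.
Qed.

Lemma eval_scale v c x : eval v (sscale c x) = c *: eval v x.
Proof.
elim: x => [|[i d] x IH] /=; first by rewrite eval_nil scaler0.
by rewrite !eval_cons IH scalerDr scalerA.
Qed.

Lemma eval_bind v (g : nat -> svec F) x :
  eval v (sbind g x) = eval (fun i => eval v (g i)) x.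
Proof.
elim: x => [|[i d] x IH] /=; first by rewrite !eval_nil.
by rewrite eval_app eval_scale eval_cons IH.
Qed.

Lemma eval_coef v x :
  swf x -> eval v x = \sum_(k <- indices) scoef k x *: v k.
Proof.
elim: x => [|[i c] x IH] /=.
  by move=> _; rewrite eval_nil big1 // => k _; rewrite scale0r.
move=> /andP[ii /IH wx]; rewrite eval_cons wx.
rewrite [RHS](eq_bigr (fun k => (if k == i then c *: v k else 0) + scoef k x
  *: v k)).
  rewrite big_split /=; congr (_ + _); rewrite (bigD1_seq i) //= eqxx.
  by rewrite big1 ?addr0 // => k /negbTE->.
move=> k _; rewrite eqnE [i == k]eq_sym.
by case: eqP => [->|_]; rewrite ?add0r // scalerDl.
Qed.

Lemma seqv_eval v x y : swf x -> swf y -> seqv x y -> eval v x = eval v y.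
Proof.
move=> wx wy /forall_in_iff h; rewrite !eval_coef //.
by apply: eq_big_seq => k ki; rewrite h.
Qed.

Lemma swf_app x y : swf (sapp x y) = swf x && swf y.
Proof. by elim: x => [|p x IH] //=; rewrite IH andbA. Qed.

Lemma swf_scale c x : swf (sscale c x) = swf x.
Proof. by elim: x => [|[i d] x IH] //=; rewrite IH. Qed.

Lemma swf_bind (g : nat -> svec F) x :
  (forall i, i \in indices -> swf (g i)) -> swf x -> swf (sbind g x).
Proof.
move=> wg; elim: x => [|[i c] x IH] //= /andP[ii wx].
by rewrite swf_app swf_scale wg // IH.
Qed.

Lemma swf_entry (t : stable F) i j :
  stwf t -> swf (entry t i j).
Proof.
elim: t => [|[[k l] x] t IH] //= /andP[/and3P[_ _ wx] wt].
by do 2?case: ifP => _; rewrite ?swf_app ?wx IH.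
Qed.

Lemma swf_mul (t : stable F) x y :
  stwf t -> swf x -> swf y -> swf (smul t x y).
Proof.
move=> wt wx wy; apply: swf_bind => // i _.
by apply: swf_bind => // j _; apply: swf_entry.
Qed.

Lemma eval_basis v i : eval v [:: (i, 1)] = v i.
Proof. by rewrite eval_cons eval_nil addr0 scale1r. Qed.

Lemma swf_mrow (m : seq (svec F)) i : all (fun x => swf x) m -> swf (mrow m i).
Proof.
move=> wm; rewrite /mrow; case: (ltnP i.-1 (size m)) => h.
  by apply: (allP wm); apply: mem_nth.
by rewrite nth_default.
Qed.

End Eval.

Section Multiplies.
Variables (F : fieldType) (V : vectType F) (mul : {bilinear V -> V -> V}).
Implicit Types (v : nat -> V) (x y : svec F) (t : stable F) (m : seq (svec F)).
Local Notation "x · y" := (mul x y) (at level 40, left associativity).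

Definition generates (a : V) : Prop :=
  forall U : {vspace V}, subalgebra mul U -> a \in U -> U = fullv.

Definition multiplies v t : Prop :=
  forall i j, i \in indices -> j \in indices -> v i · v j = eval v (entry t i
    j).

(** The predicates restrict which products must already be known: in [framed_words] one factor is a
    single basis vector of small index, and the table is established only for such indices. *)
Lemma mul_eval v t (A B : pred nat) x y :
  (forall i j, A i -> B j -> v i · v j = eval v (entry t i j)) ->
  all (fun p => A p.1) x -> all (fun p => B p.1) y ->
  eval v x · eval v y = eval v (smul t x y).
Proof.
move=> vt Ax By; rewrite /smul eval_bind.
elim: x Ax => [|[i c] x IH] /=; first by rewrite !eval_nil linear0l.
move=> /andP[Ai /IH{}IH]; rewrite !eval_cons linearDl linearZl_LR IH //=.
congr (_ *: _ + _); rewrite eval_bind.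
elim: y By {IH} => [|[j d] y IH] /=; first by rewrite !eval_nil linear0r.
by move=> /andP[Bj By]; rewrite !eval_cons linearDr linearZr_LR IH //= vt.
Qed.

Lemma multiplies_eval v t x y : multiplies v t -> swf x -> swf y ->
  eval v x · eval v y = eval v (smul t x y).
Proof. by move=> vt; apply: mul_eval. Qed.

Lemma multiplies_change v t m t' :
  multiplies v t -> stwf t -> all (fun x => swf x) m ->
  stwf t' ->
  intertwines t m t' -> multiplies (fun i => eval v (mrow m i)) t'.
Proof.
move=> vt wt wm wt' /forall_in_iff h i j ii jj.
rewrite (multiplies_eval vt) ?swf_mrow // -eval_bind.
apply: seqv_eval; first by rewrite swf_mul ?swf_mrow.
  by apply: swf_bind; rewrite ?swf_entry // => k _; rewrite swf_mrow.
by have /forall_in_iff := h i ii; apply.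
Qed.

End Multiplies.

(** * From a multiplying family to an isomorphism *)

Section TableIso.
Variables (F : fieldType) (V : vectType F) (mul : {bilinear V -> V -> V}).
Variables (v : nat -> V) (t : table F) (s : stable F).
Hypotheses (dimV : \dim {:V} = 6%N) (gen : generates mul (v 1)).
Hypotheses (enc : encodes t s) (ws : stwf s).
Hypotheses (vs : multiplies mul v s).

Let f (x : 'rV[F]_6) : V := \sum_(i < 6) x 0 i *: v i.+1.

Fact f_linear : linear f.
Proof.
move=> c x y; rewrite /f scaler_sumr -big_split; apply: eq_bigr => i _.
by rewrite !mxE scalerDl scalerA.
Qed.

HB.instance Definition _ := GRing.isLinear.Build F 'rV[F]_6 V *:%R f f_linear.

Lemma e_coord k (j : 'I_6) : k \in indices -> (e F k) 0 j = (j.+1 == k)%:R.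
Proof.
move=> kk; rewrite /e mxE eqxx /= -val_eqE /= inordK; first by case: k kk.
by rewrite !inE in kk; repeat (case/orP: kk => [/eqP->|kk] //); move/eqP: kk
  => ->.
Qed.

Lemma f_e k : k \in indices -> f (e F k) = v k.
Proof.
move=> kk; have [k0 ek] : (k.-1 < 6)%N /\ k.-1.+1 = k.
  by rewrite !inE in kk; repeat (case/orP: kk => [/eqP->|kk] //); move/eqP: kk
    => ->.
rewrite /f (bigD1 (inord k.-1)) //= e_coord // big1 ?addr0; last first.
  move=> i ne; rewrite e_coord // (_ : _ == _ = false) ?scale0r //.
  apply: contraNF ne => /eqP ik; apply/eqP/val_inj.
  by rewrite /= inordK // -ik.
by rewrite inordK // ek eqxx scale1r.
Qed.

Lemma f_row_expr r x : row_expr r x -> swf x -> f r = eval v x.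
Proof.
elim=> [k|r1 x1 r2 x2 _ IH1 _ IH2|c r1 x1 _ IH|r1 x1 _ IH] /=.
- by rewrite andbT => kk; rewrite f_e // eval_basis.
- by rewrite swf_app => /andP[w1 w2]; rewrite eval_app -IH1 // -IH2 // linearD.
- by rewrite swf_scale => w1; rewrite eval_scale -IH // linearZ.
by rewrite swf_scale => w1; rewrite eval_scale -IH // linearN scaleN1r.
Qed.

Lemma eval_entry_cons k l x (s' : stable F) i j :
  eval v (entry ((k, l, x) :: s') i j) =
  (if (k == i) && (l == j) then eval v x else 0) + eval v (entry s' i j).
Proof.
by rewrite /= !eqnE; do 2?case: eqP => _ //=; rewrite ?add0r // eval_app.
Qed.

Lemma f_table x y :
  f (table_mul t x y) = \sum_(i < 6) \sum_(j < 6)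
    (x 0 i * y 0 j) *: eval v (entry s i.+1 j.+1).
Proof.
rewrite /table_mul; elim: enc ws => [_|k l r z t' s' rz _ IH /=].
  rewrite big_nil linear0 big1 // => i _; rewrite big1 // => j _.
  by rewrite /= eval_nil scaler0.
move=> /andP[/and3P[kk ll wz] ws']; rewrite big_cons linearD linearZ /= IH //.
rewrite (f_row_expr rz) //.
have lt k' : k' \in indices -> (k'.-1 < 6)%N /\ k'.-1.+1 = k'.
  by rewrite !inE; repeat (case/orP => [/eqP->|] //); move/eqP=> ->.
have [k6 ek] := lt _ kk; have [l6 el] := lt _ ll.
under [RHS]eq_bigr => i _ do under eq_bigr => j _ do rewrite eval_entry_cons
  scalerDr.
under [RHS]eq_bigr => i _ do rewrite big_split /=.
rewrite big_split /=; congr (_ + _).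
rewrite (bigD1 (inord k.-1)) //= [X in _ = _ + X]big1 => [|i ne]; last first.
  rewrite big1 // => j _; rewrite (_ : k == i.+1 = false) ?scaler0 //.
  apply: contraNF ne => /eqP ki; apply/eqP/val_inj.
  by rewrite /= inordK // ki.
rewrite addr0 (bigD1 (inord l.-1)) //= [X in _ = _ + X]big1 => [|j ne]; last
  first.
  rewrite (_ : l == j.+1 = false) ?andbF ?scaler0 //.
  apply: contraNF ne => /eqP lj; apply/eqP/val_inj.
  by rewrite /= inordK // lj.
by rewrite !inordK // ek el !eqxx addr0.
Qed.

Lemma f_mul x y : f (table_mul t x y) = mul (f x) (f y).
Proof.
rewrite f_table {2}/f linear_sumlz; apply: eq_bigr => i _.
rewrite linearZl_LR /= linear_sumr scaler_sumr; apply: eq_bigr => j _.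
rewrite linearZr_LR scalerA vs //.
  by case: i => [[|[|[|[|[|[|i]]]]]] ?].
by case: j => [[|[|[|[|[|[|j]]]]]] ?].
Qed.

(** The map e_i to v_i is a morphism whose image is a subalgebra containing the generator, hence V;
    equal dimensions make it injective, and its inverse is the isomorphism. *)
Lemma table_isomorphic : isomorphic mul (table_mul t).
Proof.
pose g := linfun f.
have gE x : g x = f x by rewrite lfunE.
have g_full : limg g = fullv.
  apply: gen => [_ _ /memv_imgP[x _ ->] /memv_imgP[y _ ->]|].
    by rewrite !gE -f_mul -gE memv_img ?memvf.
  by rewrite -(@f_e 1) // -gE memv_img ?memvf.
have g_inj : lker g == 0%VS.
  have := limg_ker_dim g fullv.
  rewrite capfv g_full dimV dimvf /dim /= mul1n => /eqP.
  by rewrite -[X in _ == X]add0n eqn_add2r dimv_eq0.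
have gK := lker0_lfunK g_inj.
have gKV x : g ((g^-1)%VF x) = x by rewrite limg_lfunVK // g_full memvf.
exists (g^-1)%VF; split; first by exists g.
move=> x y; apply: (can_inj gK); rewrite gKV !gE f_mul -!gE !gKV //.
Qed.

End TableIso.

(** * Powers of a nilpotent algebra *)

Section Powers.
Variables (F : fieldType) (V : vectType F) (mul : {bilinear V -> V -> V}).
Local Notation "x · y" := (mul x y) (at level 40, left associativity).
Implicit Types (U W X : {vspace V}) (x y z : V).

Definition vprod U W : {vspace V} :=
  <<[seq x · y | x <- vbasis U, y <- vbasis W]>>%VS.

Lemma memv_vprod U W x y : x \in U -> y \in W -> x · y \in vprod U W.
Proof.
move=> xU yW; rewrite (coord_vbasis xU) (coord_vbasis yW) linear_sumlz.
apply: memv_suml => i _; rewrite linearZl_LR memvZ //= linear_sumr.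
apply: memv_suml => j _; rewrite linearZr_LR memvZ //= memv_span //.
by apply: allpairs_f; apply: mem_nth; rewrite size_tuple.
Qed.

Lemma vprod_subP U W X :
  (forall x y, x \in U -> y \in W -> x · y \in X) -> (vprod U W <= X)%VS.
Proof.
move=> h; apply/span_subvP => _ /allpairsP[[x y] /= [xU yW ->]].
by apply: h; apply: vbasis_mem.
Qed.

(** Only products with V on one side are added at each step. This keeps inductions short, and any
    subspace containing all products of n + 1 elements still contains [lcs n]. *)
Fixpoint lcs (n : nat) : {vspace V} :=
  if n is n'.+1 then (vprod fullv (lcs n') + vprod (lcs n') fullv)%VS
  else fullv.

(* The power V^k, with the convention V^0 = V^1 = V. *)
Definition pw k := lcs k.-1.

Lemma pwMl k x y : (0 < k)%N -> y \in pw k -> x · y \in pw k.+1.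
Proof.
case: k => // k _ yk; rewrite /pw /=; apply: (subvP (addvSl _ _)).
by rewrite memv_vprod ?memvf.
Qed.

Lemma pwMr k x y : (0 < k)%N -> x \in pw k -> x · y \in pw k.+1.
Proof.
case: k => // k _ yk; rewrite /pw /=; apply: (subvP (addvSr _ _)).
by rewrite memv_vprod ?memvf.
Qed.

Lemma pw_subP k X : (0 < k)%N ->
  (forall x y, y \in pw k -> x · y \in X) ->
  (forall x y, x \in pw k -> x · y \in X) -> (pw k.+1 <= X)%VS.
Proof.
case: k => // k _ hl hr; rewrite /pw /= subv_add.
by apply/andP; split; apply: vprod_subP => x y xk yk; [apply: hl|apply: hr].
Qed.

Lemma pw_sub k : (pw k.+1 <= pw k)%VS.
Proof.
case: k => [|k]; first exact: subvf.
elim: k => [|k IH]; first exact: subvf.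
by apply: pw_subP => // x y h; [apply: pwMl|apply: pwMr] => //; apply: (subvP
  IH).
Qed.

Lemma pw_le j k : (j <= k)%N -> (pw k <= pw j)%VS.
Proof.
move=> /subnKC <-; elim: (k - j)%N => [|n IH]; first by rewrite addn0.
by rewrite addnS (subv_trans (pw_sub _)).
Qed.

Lemma memv_pw2 x y : x · y \in pw 2.
Proof. by apply: pwMl => //; apply: memvf. Qed.

Lemma pw_stable k : (0 < k)%N -> pw k.+1 = pw k ->
  forall n, pw (k + n) = pw k.
Proof.
case: k => // k _ e n; elim: n => [|n IH]; first by rewrite addn0.
by rewrite addnS -[RHS]e; rewrite /pw addSn /= in IH *; rewrite IH.
Qed.

Lemma nprod_pw k X : (forall x, nprod mul k.+1 x -> x \in X) -> (pw k.+1 <=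
  X)%VS.
Proof.
elim: k X => [|k IH] X h; first by apply/subvP => x _; apply/h/Nprod1.
rewrite /pw /= subv_add; apply/andP; split; apply: vprod_subP => x y.
  move=> _ yk; have : (pw k.+1 <= linfun (mul x) @^-1: X)%VS.
    apply: IH => z zk; rewrite -memv_preim lfunE; apply: h.
    exact: (@NprodM _ _ _ 1 k.+1 x z (Nprod1 _ _) zk).
  by move=> /subvP/(_ y yk); rewrite -memv_preim lfunE.
move=> xk _; have : (pw k.+1 <= linfun (applyr mul y) @^-1: X)%VS.
  apply: IH => z zk; rewrite -memv_preim lfunE; apply: h.
  rewrite -addn1; exact: (NprodM zk (Nprod1 _ y)).
by move=> /subvP/(_ x xk); rewrite -memv_preim lfunE.
Qed.

Hypothesis nilp : nilpotent mul.

Lemma pw_eq0 : exists k, pw k = 0%VS.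
Proof.
have [[//|k] _ h] := nilp; exists k.+1; apply/eqP; rewrite -subv0.
by apply: nprod_pw => x /h ->; rewrite mem0v.
Qed.

(** Each power is determined by the preceding one, so a chain that stops descending once is constant
    from there on; nilpotency makes the constant zero. *)
Lemma pw_stable0 k : (0 < k)%N -> (pw k <= pw k.+1)%VS -> pw k = 0%VS.
Proof.
move=> k0 h; have e : pw k.+1 = pw k by apply/eqP; rewrite eqEsubv pw_sub h.
have [n n0] := pw_eq0; apply/eqP; rewrite -subv0 -n0 -(pw_stable k0 e n).
exact/pw_le/leq_addl.
Qed.

Lemma pw_dim_lt k : (0 < k)%N -> pw k != 0%VS -> (\dim (pw k.+1) < \dim (pw
  k))%N.
Proof.
move=> k0; apply: contraNltn => h; apply/eqP/pw_stable0 => //.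
by rewrite -(geq_leqif (dimv_leqif_sup (pw_sub k))).
Qed.

Lemma generates_full a : generates mul a -> (<[a]> + pw 2)%VS = fullv.
Proof.
apply; last by rewrite (subvP (addvSl _ _)) // memv_line.
by move=> x y _ _; apply/(subvP (addvSr _ _))/memv_pw2.
Qed.

(** A Nakayama argument: if a subalgebra U contains c a + y, then U + V^(k+1) = V by induction on k.
    Multiplying two such decompositions gives V^2 inside U + V^(k+2), so y and then a lie there
    too. *)
Lemma generates_shift a c y :
  generates mul a -> c != 0 -> y \in pw 2 -> generates mul (c *: a + y).
Proof.
move=> ga c0 y2 U sU aU.
suff h k : (U + pw k.+1)%VS = fullv.
  by have [k k0] := pw_eq0; apply/eqP; rewrite eqEsubv subvf -(h k) subv_add
    subvv (subv_trans (pw_sub k)) // k0 sub0v.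
elim: k => [|k IH]; first by apply/eqP; rewrite eqEsubv subvf addvSr.
have s2 : (pw 2 <= U + pw k.+2)%VS.
  have h u w : u · w \in (U + pw k.+2)%VS.
    have := memvf u; rewrite -IH => /memv_addP[u1 uU [u2 uk ->]].
    have := memvf w; rewrite -IH => /memv_addP[w1 wU [w2 wk ->]].
    rewrite linearDl !linearDr /= -addrA; apply: memv_add; first exact: sU.
    by apply: memvD; [exact: pwMl|apply: memvD; exact: pwMr].
  by apply: pw_subP => // ? ? _; apply: h.
apply/eqP; rewrite eqEsubv subvf /= -(generates_full ga) subv_add s2 andbT.
rewrite -memvE.
have -> : a = c^-1 *: ((c *: a + y) - y) by rewrite addrK scalerK.
apply/memvZ/memvB; [exact: (subvP (addvSl _ _))|exact: (subvP s2)].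
Qed.

End Powers.

(** * Tables determined by the products with the generator *)

Section NovikovTables.
Variables (F : fieldType).
Implicit Types (t : stable F) (x y : svec F).

Definition ssub x y := sapp x (sscale (-1) y).
Definition sbasis (i : nat) : svec F := [:: (i, 1)].

(* A word term [(c, true, k)] stands for [c (e_1 e_k)], and [(c, false, k)]   *)
(* for [c (e_k e_1)].                                                         *)
Definition wordsum := seq (F * bool * nat).

Fixpoint sword (g : bool -> nat -> svec F) (w : wordsum) : svec F :=
  if w is (c, b, k) :: w' then sapp (sscale c (g b k)) (sword g w') else [::].

Definition word_val t w :=
  sword (fun b k => if b then entry t 1 k else entry t k 1) w.

(* The identity L_{xy} = R_y L_x, applied to e_j. *)
Definition word_left t w j :=
  sword (fun b k => if b then smul t (entry t 1 j) (sbasis k)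
                    else smul t (entry t k j) (sbasis 1)) w.

(* The identity R_{xy} = R_y R_x - R_y L_x + L_x R_y, applied to e_j. *)
Definition word_right t w j :=
  sword (fun b k =>
    if b then sapp (ssub (smul t (entry t j 1) (sbasis k))
                         (smul t (entry t 1 j) (sbasis k)))
                   (smul t (sbasis 1) (entry t j k))
    else sapp (ssub (smul t (entry t j k) (sbasis 1))
                    (smul t (entry t k j) (sbasis 1)))
              (smul t (sbasis k) (entry t j 1))) w.

(** The list [ws] starts with the word for e_2, whence the index i - 2. Row and column i of the
    table must be those that the identities for L_{xy} and R_{xy} derive from the word for e_i. *)
Definition generated_by t (ws : seq wordsum) : Prop :=
  forall_in [:: 2; 3; 4; 5; 6]%N (fun i => let w := nth [::] ws i.-2 in
    seqv (sbasis i) (word_val t w) /\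
    forall_in indices (fun j =>
      seqv (entry t i j) (word_left t w j) /\
      seqv (entry t j i) (word_right t w j))).

Definition word_lt i (w : wordsum) := all (fun p => (0 < p.2 < i)%N) w.

Fixpoint words_wf i (ws : seq wordsum) :=
  if ws is w :: ws' then word_lt i w && words_wf i.+1 ws' else true.

(** Weaker than the name suggests: the first row is c e_1 plus terms in e_2, ..., e_6 with c
    nonzero, and the other rows merely avoid e_1. This keeps the first vector a generator and the
    others in V^2. *)
Definition unitriangular (m : seq (svec F)) : Prop :=
  if m is ((i, c) :: x) :: m' then
    [/\ i = 1%N, c != 0, all (fun p => p.1 \in behead indices) x
      & all (fun x => all (fun p => p.1 \in behead indices) x) m']
  else False.

End NovikovTables.

Section Framed.
Variables (F : fieldType) (V : vectType F) (mul : {bilinear V -> V -> V}).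
Hypotheses (nov : novikov mul) (nilp : nilpotent mul).
Local Notation "x · y" := (mul x y) (at level 40, left associativity).
Implicit Types (v : nat -> V) (t : stable F) (x y z : V) (X : svec F).

Lemma mulAC x y z : (x · y) · z = (x · z) · y.
Proof. exact: (proj1 nov). Qed.

Lemma mulr_mul x y z : z · (x · y) = (z · x) · y - (x · z) · y + x · (z · y).
Proof.
by rewrite addrAC -addrA -opprB -[x · z · y - _](proj2 nov) subKr.
Qed.

(** Independence of the vectors is not part of the notion. Membership in V^2 is recorded so that a
    change of generator can be followed by another one. *)
Definition framed v t : Prop :=
  [/\ generates mul (v 1), {in behead indices, forall i, v i \in pw mul 2},
      stwf t & multiplies mul v t].

Lemma framed_change v t m t' :
  framed v t -> unitriangular m -> stwf t' -> intertwines t m t' ->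
  framed (fun i => eval v (mrow m i)) t'.
Proof.
case: m => [|[|[i c] x] m] //= [gv v2 wt vt] [i1 c0 xm mm] wt' tm.
have ev (y : svec F) : all (fun p => p.1 \in behead indices) y -> eval v y \in
  pw mul 2.
  by move=> /allP h; rewrite /eval big_seq; apply: rpred_sum => p /h /v2;
    apply: memvZ.
have sub (y : svec F) : all (fun p => p.1 \in behead indices) y -> swf y.
  by apply: sub_all => p /mem_behead.
split=> //.
- by rewrite /= eval_cons i1; apply: generates_shift => //; apply: ev.
- move=> j /=; case: j => [|[|j]] // _; rewrite /mrow /=.
  case: (ltnP j (size m)) => h; last by rewrite nth_default // eval_nil mem0v.
  by apply/ev/(allP mm)/mem_nth.
apply: (multiplies_change vt) => //=; rewrite i1 /= (sub x) //=.
by apply/allP => y /(allP mm); apply: sub.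
Qed.

Lemma eval_sub v (x y : svec F) : eval v (ssub x y) = eval v x - eval v y.
Proof. by rewrite eval_app eval_scale scaleN1r. Qed.

Lemma eval_word v (g : bool -> nat -> svec F) (w : wordsum F) :
  eval v (sword g w) = \sum_(p <- w) p.1.1 *: eval v (g p.1.2 p.2).
Proof.
elim: w => [|[[c b] k] w IH] /=; first by rewrite eval_nil big_nil.
by rewrite eval_app eval_scale IH big_cons.
Qed.

Lemma swf_word (g : bool -> nat -> svec F) i (w : wordsum F) :
  word_lt i w -> (forall b k, (0 < k < i)%N -> swf (g b k)) -> swf (sword g w).
Proof.
move=> + wg; elim: w => [|[[c b] k] w IH] //= /andP[ki /IH ww].
by rewrite swf_app swf_scale wg.
Qed.

Lemma eval_word_lt v (g : bool -> nat -> svec F) (h : bool -> nat -> V) i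
    (w : wordsum F) : word_lt i w ->
  (forall b k, (0 < k < i)%N -> eval v (g b k) = h b k) ->
  eval v (sword g w) = \sum_(p <- w) p.1.1 *: h p.1.2 p.2.
Proof.
move=> /allP wi gh; rewrite eval_word; apply: eq_big_seq => p /wi pi.
by rewrite gh.
Qed.

(** Induction on i: v_i is a combination of products of v_1 with vectors of smaller index, so the
    identities for L_{xy} and R_{xy} compute both v_i v_j and v_j v_i from known products, and
    [generated_by] says that the table gives the same result. *)
Lemma framed_words v t ws :
  generates mul (v 1%N) -> stwf t ->
  {in indices, forall j, v 1%N · v j = eval v (entry t 1 j)} ->
  {in indices, forall j, v j · v 1%N = eval v (entry t j 1)} ->
  words_wf 2 ws -> generated_by t ws ->
  framed v t.
Proof.
move=> gv wt v1l v1r ww /forall_in_iff gb.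
have idx i j : j \in indices -> (0 < i < j)%N -> i \in indices.
  move=> jj /andP[i0 ij].
  have := leq_trans ij (allP (isT : all (leq^~ 6) indices) j jj).
  by case: i i0 {ij} => [|[|[|[|[|[|i]]]]]].
have lt_w i : (1 < i)%N -> word_lt i (nth [::] ws i.-2).
  case: i => [|[|i]] // _ /=.
  have h : forall m (ws' : seq (wordsum F)), words_wf m ws' -> word_lt (m + i)
    (nth [::] ws' i).
    elim: i => [|i IH] m [|w ws1] //=; first by rewrite addn0 => /andP[].
    by rewrite addnS -addSn => /andP[_]; apply: IH.
  exact: (h 2%N).
have se (x y : svec F) : seqv x y -> swf x -> swf y -> eval v x = eval v y.
  by move=> h wx wy; apply: seqv_eval.
have tail i : i \in indices -> (1 < i)%N -> i \in [:: 2; 3; 4; 5; 6]%N.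
  by rewrite inE => /orP[/eqP->|].
have wm (x y : svec F) : swf x -> swf y -> swf (smul t x y) by apply: swf_mul.
have we i j : swf (entry t i j) by apply: swf_entry.
have wb i : i \in indices -> swf (@sbasis F i) by move=> h; rewrite /= h.
have ws2 (x y : svec F) : swf x -> swf y -> swf (ssub x y).
  by move=> h h'; rewrite swf_app h swf_scale.
pose h b k := if b then v 1%N · v k else v k · v 1%N.
have vE i : i \in indices -> (1 < i)%N ->
    v i = \sum_(p <- nth [::] ws i.-2) p.1.1 *: h p.1.2 p.2.
  move=> ii i1; have [hv _] := gb _ (tail i ii i1).
  rewrite -(eval_basis v i) (se _ _ hv) ?wb //; last first.
    by apply: (swf_word (lt_w _ i1)) => -[] k ki; apply: we.
  apply: (eval_word_lt (lt_w _ i1)) => -[] k ki /=.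
    by rewrite v1l // (idx _ _ ii).
  by rewrite v1r // (idx _ _ ii).
have main n i j : (i <= n)%N -> i \in indices -> j \in indices ->
    v i · v j = eval v (entry t i j) /\ v j · v i = eval v (entry t j i).
  elim: n i j => [|n IH] i j; first by rewrite leqn0 => /eqP->.
  rewrite leq_eqVlt ltnS => /orP[/eqP->{i}|le_in] ii jj; last exact: IH.
  case: n IH ii => [|n] IH ii; first by rewrite v1l ?v1r.
  have [_ /forall_in_iff/(_ j jj)[hl hr]] := gb n.+2 (tail _ ii isT).
  have lw := lt_w n.+2 isT.
  have ik k : (0 < k < n.+2)%N -> (k <= n.+1)%N /\ k \in indices.
    by move=> hk; split; [case/andP: hk | apply: idx hk].
  (* The induction hypothesis covers products in which one factor, on either side, is a v_k of
     smaller index. *)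
  have mE (x : svec F) k b : swf x -> (0 < k < n.+2)%N ->
      eval v (if b then smul t x (sbasis F k) else smul t (sbasis F k) x) =
      if b then eval v x · v k else v k · eval v x.
    move=> wx /ik[kn ki]; case: b; rewrite -(eval_basis v k);
      [rewrite (@mul_eval _ _ _ v t (mem indices) (pred1 k)) //= ?eqxx //
      |rewrite (@mul_eval _ _ _ v t (pred1 k) (mem indices)) //= ?eqxx //];
      by [move=> i' j' h1 /eqP->; have [] := IH k i' kn ki h1
         |move=> i' j' /eqP-> h1; have [] := IH k j' kn ki h1].
  have mEl (x : svec F) k (kk : (0 < k < n.+2)%N) (wx : swf x) := mE x k true
    wx kk.
  have mEr (x : svec F) k (kk : (0 < k < n.+2)%N) (wx : swf x) := mE x k false
    wx kk.
  rewrite (vE n.+2) // (se _ _ hl) ?(se _ _ hr) //.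
  - split.
      rewrite linear_sumlz (@eval_word_lt _ _ (fun b k => h b k · v j) _ _ lw).
        by apply: eq_bigr => p _; rewrite linearZl_LR.
      move=> [] k ki; have [kn kk] := ik k ki.
        by rewrite mEl // -v1l // /h mulAC.
      by rewrite (mEl _ 1%N) // /h; have [<- _] := IH k j kn kk jj; rewrite
        mulAC.
    rewrite linear_sumr (@eval_word_lt _ _ (fun b k => v j · h b k) _ _ lw).
      by apply: eq_bigr => p _; rewrite linearZr_LR.
    move=> [] k ki; have [kn kk] := ik k ki; have [e1 e2] := IH k j kn kk jj.
      rewrite eval_app eval_sub !mEl // (mEr _ 1%N) //.
      by rewrite -v1l // -v1r // -e2 /h [RHS]mulr_mul.
    rewrite eval_app eval_sub !(mEl _ 1%N) // (mEr _ k) //.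
    by rewrite -v1r // -e1 -e2 /h [RHS]mulr_mul.
  - apply: (swf_word lw) => -[] k ki; rewrite swf_app ws2 ?wm ?wb //;
    by case: (ik k ki).
  - apply: (swf_word lw) => -[] k ki; rewrite wm ?wb //; by case: (ik k ki).
split=> //; last first.
  move=> i j ii jj; exact: (proj1 (main i i j (leqnn i) ii jj)).
move=> i i2; have i1 : (1 < i)%N by case: i i2 => [|[]].
rewrite (vE i (mem_behead i2) i1).
by apply: rpred_sum => p _; apply: memvZ; rewrite /h; case: ifP => _; apply:
  memv_pw2.
Qed.

End Framed.

(** * The parametrised tables *)

Section Tables.
Variable F : fieldType.
Implicit Types a b c g k l m p q : F.

(* The basis starts with e_1, e_1 e_1, e_1 (e_1 e_1), (e_1 e_1) e_1 in the    *)
(* families A and B. In D and E, e_1 (e_1 e_1) = e_3 and the parameters       *)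
(* describe (e_1 e_1) e_1 = l e_3 + a e_4 + b e_5 + g e_6, with l = 0 in D;   *)
(* I is the limit l = oo of E, with (e_1 e_1) e_1 = e_3 and                   *)
(* e_1 (e_1 e_1) = a e_4 + b e_5 + g e_6.                                     *)
Definition tA1 : stable F :=
  [:: 1 ** 1 |-> [:: 1 @ 2]; 1 ** 2 |-> [:: 1 @ 3]; 1 ** 3 |-> [:: 1 @ 5];
      1 ** 4 |-> [:: 1 @ 6]; 2 ** 1 |-> [:: 1 @ 4]; 4 ** 1 |-> [:: - 1 @ 6]].

Definition tA2 l : stable F :=
  [:: 1 ** 1 |-> [:: 1 @ 2]; 1 ** 2 |-> [:: 1 @ 3]; 1 ** 3 |-> [:: 1 @ 5];
      1 ** 4 |-> [:: l @ 6]; 2 ** 1 |-> [:: 1 @ 4]; 2 ** 2 |-> [:: 1 @ 6];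
      3 ** 1 |-> [:: 1 @ 6]; 4 ** 1 |-> [:: 2 - l @ 6]].

Definition tA3 l m : stable F :=
  [:: 1 ** 1 |-> [:: 1 @ 2]; 1 ** 2 |-> [:: 1 @ 3];
      1 ** 3 |-> [:: l @ 5; m @ 6]; 1 ** 4 |-> [:: 1 @ 5];
      2 ** 1 |-> [:: 1 @ 4]; 2 ** 2 |-> [:: 1 @ 6]; 3 ** 1 |-> [:: 1 @ 6];
      4 ** 1 |-> [:: - 1 @ 5; 2 @ 6]].

(** In family B the cases are: C outside V^5 ([tB1]); C in V^5 but not B ([tB2]); both in V^5, with
    A a nonzero ([tB3]) or zero ([tB4]). *)
Definition tB1 l m a b : stable F :=
  [:: 1 ** 1 |-> [:: 1 @ 2]; 1 ** 2 |-> [:: 1 @ 3];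
      1 ** 3 |-> [:: l @ 5; a @ 6]; 1 ** 4 |-> [:: m @ 5; b @ 6];
      1 ** 5 |-> [:: 2 * m - 1 @ 6]; 2 ** 1 |-> [:: 1 @ 4];
      2 ** 2 |-> [:: 1 @ 5]; 2 ** 3 |-> [:: l * (2 - m) @ 6];
      2 ** 4 |-> [:: m * (2 - m) @ 6]; 3 ** 1 |-> [:: 1 @ 5];
      3 ** 2 |-> [:: 3 - (l + 1) * (2 - m) @ 6];
      4 ** 1 |-> [:: 2 - m @ 5; - b @ 6]; 4 ** 2 |-> [:: 2 - m @ 6];
      5 ** 1 |-> [:: 2 - m @ 6]].

Definition tB2 p a c : stable F :=
  [:: 1 ** 1 |-> [:: 1 @ 2]; 1 ** 2 |-> [:: 1 @ 3];
      1 ** 3 |-> [:: p @ 5; a @ 6]; 1 ** 4 |-> [:: 1 @ 5];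
      1 ** 5 |-> [:: - 2 @ 6]; 2 ** 1 |-> [:: 1 @ 4]; 2 ** 2 |-> [:: c @ 6];
      2 ** 3 |-> [:: p @ 6]; 2 ** 4 |-> [:: 1 @ 6]; 3 ** 1 |-> [:: c @ 6];
      3 ** 2 |-> [:: - p @ 6]; 4 ** 1 |-> [:: - 1 @ 5; 2 * c @ 6];
      5 ** 1 |-> [:: 1 @ 6]].

Definition tB3 q c l : stable F :=
  [:: 1 ** 1 |-> [:: 1 @ 2]; 1 ** 2 |-> [:: 1 @ 3]; 1 ** 3 |-> [:: 1 @ 5];
      1 ** 4 |-> [:: q @ 6]; 1 ** 5 |-> [:: l @ 6]; 2 ** 1 |-> [:: 1 @ 4];
      2 ** 2 |-> [:: c @ 6]; 2 ** 3 |-> [:: 1 @ 6]; 3 ** 1 |-> [:: c @ 6];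
      3 ** 2 |-> [:: - 1 @ 6]; 4 ** 1 |-> [:: 2 * c - q @ 6];
      5 ** 1 |-> [:: 1 @ 6]].

Definition tB4 q c : stable F :=
  [:: 1 ** 1 |-> [:: 1 @ 2]; 1 ** 2 |-> [:: 1 @ 3]; 1 ** 3 |-> [:: 1 @ 5];
      1 ** 4 |-> [:: q @ 6]; 1 ** 5 |-> [:: 1 @ 6]; 2 ** 1 |-> [:: 1 @ 4];
      2 ** 2 |-> [:: c @ 6]; 3 ** 1 |-> [:: c @ 6];
      4 ** 1 |-> [:: 2 * c - q @ 6]].

Definition tD a b c : stable F :=
  [:: 1 ** 1 |-> [:: 1 @ 2]; 1 ** 2 |-> [:: 1 @ 3]; 1 ** 3 |-> [:: 1 @ 4];
      1 ** 4 |-> [:: 1 @ 5]; 2 ** 1 |-> [:: a @ 4; b @ 5; c @ 6];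
      2 ** 2 |-> [:: a / 2 @ 5; a / 2 @ 6]; 2 ** 3 |-> [:: 1 @ 6];
      3 ** 1 |-> [:: a / 2 @ 5; a / 2 @ 6]; 3 ** 2 |-> [:: - 1 @ 6];
      4 ** 1 |-> [:: 1 @ 6]].

(** With z = x4 - l x3, the numbers x and y are the coordinates of (a z + z a) / 2 on e_5 and e_6; k
    measures the failure of e_4 e_1 = l e_5. *)
Definition tE l a b g k : stable F :=
  let x := (3 - l) * a / 2 in let y := k * a / 2 + (2 - l) * b in
  [:: 1 ** 1 |-> [:: 1 @ 2]; 1 ** 2 |-> [:: 1 @ 3];
      1 ** 3 |-> [:: 2 - l @ 4; - x @ 5; - y @ 6];
      1 ** 4 |-> [:: 3 - 2 * l @ 5; 2 * k @ 6]; 1 ** 5 |-> [:: 4 - 3 * l @ 6];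
      2 ** 1 |-> [:: l @ 3; a @ 4; b @ 5; g @ 6];
      2 ** 2 |-> [:: l @ 4; x @ 5; y @ 6];
      2 ** 3 |-> [:: l * (2 - l) @ 5; (l - 2) * k - l * x @ 6];
      2 ** 4 |-> [:: l * (3 - 2 * l) @ 6]; 3 ** 1 |-> [:: l @ 4; x @ 5; y @ 6];
      3 ** 2 |-> [:: l @ 5; 2 * k + (4 - l) * x @ 6];
      3 ** 3 |-> [:: l * (2 - l) @ 6]; 4 ** 1 |-> [:: l @ 5; - k @ 6];
      4 ** 2 |-> [:: l @ 6]; 5 ** 1 |-> [:: l @ 6]].

Definition tI a b g : stable F :=
  [:: 1 ** 1 |-> [:: 1 @ 2]; 1 ** 2 |-> [:: a @ 4; b @ 5; g @ 6];
      1 ** 3 |-> [:: 1 @ 4]; 1 ** 4 |-> [:: 2 @ 5; 5 * a @ 6];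
      1 ** 5 |-> [:: 3 @ 6]; 2 ** 1 |-> [:: 1 @ 3];
      2 ** 2 |-> [:: - a @ 5; - b - 5 * a ^+ 2 @ 6];
      2 ** 3 |-> [:: - 1 @ 5; - (5 * a) @ 6]; 2 ** 4 |-> [:: - 2 @ 6];
      3 ** 1 |-> [:: - 1 @ 4; - (2 * a) @ 5; - (2 * b) - 10 * a ^+ 2 @ 6];
      3 ** 2 |-> [:: a @ 6]; 3 ** 3 |-> [:: 1 @ 6];
      4 ** 1 |-> [:: - 1 @ 5; - (5 * a) @ 6]; 5 ** 1 |-> [:: - 1 @ 6]].

Definition wB (u w : wordsum F) : seq (wordsum F) :=
  [:: [:: (1, true, 1%N)]; [:: (1, true, 2%N)]; [:: (1, false, 2%N)]; u; w].

Definition wD : seq (wordsum F) :=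
  [:: [:: (1, true, 1%N)]; [:: (1, true, 2%N)]; [:: (1, true, 3%N)];
      [:: (1, true, 4%N)]; [:: (1, false, 4%N)]].

(* With e_4 = (e_1 e_3 + e_3 e_1) / 2, e_5 = (e_1 e_4 + 2 e_4 e_1) / 3 and    *)
(* e_6 = (e_1 e_5 + 3 e_5 e_1) / 4, the coefficients of the table tE are      *)
(* polynomial in l, so that no value of l is exceptional.                     *)
Definition wE : seq (wordsum F) :=
  [:: [:: (1, true, 1%N)]; [:: (1, true, 2%N)];
      [:: (1 / 2, true, 3%N); (1 / 2, false, 3%N)];
      [:: (1 / 3, true, 4%N); (2 / 3, false, 4%N)];
      [:: (1 / 4, true, 5%N); (3 / 4, false, 5%N)]].

Definition wI : seq (wordsum F) :=
  [:: [:: (1, true, 1%N)]; [:: (1, false, 2%N)]; [:: (1, true, 3%N)];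
      [:: (1, true, 4%N); (1, false, 4%N)];
      [:: (1 / 2, true, 5%N); (1 / 2, false, 5%N)]].

Definition idm : seq (svec F) :=
  [:: [:: 1 @ 1]; [:: 1 @ 2]; [:: 1 @ 3]; [:: 1 @ 4]; [:: 1 @ 5]; [:: 1 @ 6]].

(** The exponents here and in the next two matrices are the degrees of the basis vectors as words in
    the generator. *)
Definition gradm c : seq (svec F) :=
  [:: [:: c @ 1]; [:: c ^+ 2 @ 2]; [:: c ^+ 3 @ 3]; [:: c ^+ 4 @ 4];
      [:: c ^+ 5 @ 5]; [:: c ^+ 6 @ 6]].

Definition gradBm c : seq (svec F) :=
  [:: [:: c @ 1]; [:: c ^+ 2 @ 2]; [:: c ^+ 3 @ 3]; [:: c ^+ 3 @ 4];
      [:: c ^+ 4 @ 5]; [:: c ^+ 5 @ 6]].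

Definition gradDm c : seq (svec F) :=
  [:: [:: c @ 1]; [:: c ^+ 2 @ 2]; [:: c ^+ 3 @ 3]; [:: c ^+ 4 @ 4];
      [:: c ^+ 5 @ 5]; [:: c ^+ 5 @ 6]].

Definition halvesm : seq (svec F) :=
  [:: [:: 1 @ 1]; [:: 1 @ 2]; [:: 1 @ 3]; [:: 1 @ 4]; [:: 1 / 2 @ 5];
      [:: 1 / 2 @ 6]].

(* The Novikov identities for tE l a b g k amount to l * (k - kE l a) = 0. *)
Definition kE l a := - (l ^+ 2 - 6 * l + 11) * a / 6.

End Tables.

Ltac check_table := cbv [intertwines generated_by forall_in indices seqv
  smul sbind sapp sscale scoef entry mrow nth predn eqn sbasis ssub sword
  word_val word_left word_right wB wD wE wI kE idm halvesm gradm gradBm gradDm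
  tA1 tA2 tA3 tB1 tB2 tB3 tB4 tD tE tI]; repeat split; by field.

Section Generated.
Variable F : numFieldType.
Implicit Types a b c g k l m p q : F.

Let L i : wordsum F := [:: (1, true, i)].
Let R i : wordsum F := [:: (1, false, i)].

Ltac check := rewrite /L /R; check_table.

Lemma generated_A1 : generated_by (@tA1 F) (wB (L 3) (L 4)).
Proof. check. Qed.

Lemma generated_A2 l : generated_by (tA2 l) (wB (L 3) (R 3)).
Proof. check. Qed.

Lemma generated_A3 l m : generated_by (tA3 l m) (wB (L 4) (R 3)).
Proof. check. Qed.

Lemma generated_B1 l m a b :
  generated_by (tB1 l m a b)
    (wB (R 3) [:: (1 / 3, true, 5%N); (2 / 3, false, 5%N)]).
Proof. check. Qed.

Lemma generated_B2 p a c : generated_by (tB2 p a c) (wB (L 4) (R 5)).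
Proof. check. Qed.

Lemma generated_B3 q c l : generated_by (tB3 q c l) (wB (L 3) (R 5)).
Proof. check. Qed.

Lemma generated_B4 q c : generated_by (tB4 q c) (wB (L 3) (L 5)).
Proof. check. Qed.

Lemma generated_D a b c : generated_by (tD a b c) (wD F).
Proof. check. Qed.

Lemma generated_E0 a b g k : generated_by (tE 0 a b g k) (wE F).
Proof. check. Qed.

Lemma generated_E l a b g : generated_by (tE l a b g (kE l a)) (wE F).
Proof. check. Qed.

Lemma generated_Ek l a b g k :
  l * (k - kE l a) = 0 -> generated_by (tE l a b g k) (wE F).
Proof.
move/eqP; rewrite mulf_eq0 subr_eq0 => /orP[/eqP->|/eqP->].
  exact: generated_E0.
exact: generated_E.
Qed.

Lemma generated_I a b g : generated_by (tI a b g) (wI F).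
Proof. check. Qed.

End Generated.

(** * Changes of generator *)

Section Changes.
Variables (F : numClosedFieldType) (V : vectType F).
Variable mul : {bilinear V -> V -> V}.
Hypotheses (dimV : \dim {:V} = 6%N).
Hypotheses (nov : novikov mul) (nilp : nilpotent mul).
Implicit Types a b c g k l m p q s r : F.

Definition has_frame (t : stable F) : Prop := exists v, framed mul v t.

Definition classified : Prop :=
  exists2 t : table F, listed t & isomorphic mul (table_mul t).

Lemma has_frame_change t0 M t : has_frame t0 ->
  unitriangular M -> stwf t -> intertwines t0 M t -> has_frame t.
Proof.
move=> [v fr] uM wt h; exists (fun i => eval v (mrow M i)).
exact: (framed_change nilp fr).
Qed.

Lemma listed_frame t0 M t (s : stable F) : has_frame t0 -> listed t -> encodes
  t s ->
  stwf s -> unitriangular M -> intertwines t0 M s -> classified.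
Proof.
move=> fr lt enc ws uM h; exists t => //.
have [v [gv _ _ vs]] := has_frame_change fr uM ws h.
exact: (table_isomorphic dimV gv enc ws vs).
Qed.

Ltac change_basis fr M :=
  apply: (has_frame_change (M := M) fr);
  [by split=> //; exact: oner_neq0 | by [] | check_table].

(** The new generator is e_1 + s e_2, and the other rows are the words of the table in it. All the
    shift lemmas below have this form, with e_2, e_3 or e_4 added to e_1. *)
Lemma shift_B1 l m a b s :
  has_frame (tB1 l m a b) ->
  has_frame (tB1 l m (a + s * ((m + 1) * (l * (m - 2) + 2 * m - 1)))
    (b + s * ((m - 1) * (m - 2) ^+ 2))).
Proof.
move=> fr; change_basis fr (
  [:: [:: 1 @ 1; s @ 2]; [:: 1 @ 2; s @ 3; s @ 4; s ^+ 2 @ 5];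
      [:: 1 @ 3; s + l * s + m * s @ 5; a * s + b * s - s ^+ 2 + 2 * l * s ^+
        2 + 4 * m * s ^+ 2 - l * m * s ^+ 2 - m ^+ 2 * s ^+ 2 @ 6];
      [:: 1 @ 4; 4 * s - m * s @ 5; - b * s + 5 * s ^+ 2 - 2 * l * s ^+ 2 - m
        * s ^+ 2 + l * m * s ^+ 2 @ 6];
      [:: 1 @ 5; 3 * s + 2 * m * s - m ^+ 2 * s @ 6]; [:: 1 @ 6]] : seq (svec
        F)).
Qed.

Lemma shift_B2 p a s :
  has_frame (tB2 p a (- s)) ->
  has_frame (tB2 p (a - 2 * s * (2 * p + 1)) 0).
Proof.
move=> fr; change_basis fr (
  [:: [:: 1 @ 1; s @ 2]; [:: 1 @ 2; s @ 3; s @ 4; - s ^+ 3 @ 6];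
      [:: 1 @ 3; s + p * s @ 5; a * s + p * s ^+ 2 @ 6];
      [:: 1 @ 4; - s @ 5; - 4 * s ^+ 2 - p * s ^+ 2 @ 6];
      [:: 1 @ 5; 3 * s @ 6]; [:: 1 @ 6]] : seq (svec F)).
Qed.

Lemma shift_D a b g t :
  has_frame (tD a b g) ->
  has_frame (tD a b (g + 2 * t)).
Proof.
move=> fr; change_basis fr (
  [:: [:: 1 @ 1; t @ 3];
      [:: 1 @ 2; t @ 4; 1 / 2 * a * t @ 5; 1 / 2 * a * t @ 6];
      [:: 1 @ 3; t @ 5; - t @ 6]; [:: 1 @ 4]; [:: 1 @ 5]; [:: 1 @ 6]] : seq
        (svec F)).
Qed.

(** Parametrised by s to avoid division: for l other than 0 and 1 every a has this form, and e_1 + s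
    e_2 removes it, together with k = [kE l a]. *)
Lemma shift_E l b g s : let a := l ^+ 2 * (1 - l) * s in
  has_frame (tE l a b g (kE l a)) ->
  exists b' g', has_frame (tE l 0 b' g' 0).
Proof.
move=> a fr.
exists (b + l * s ^+ 2 - 7 / 2 * l ^+ 3 * s ^+ 2 + 11 / 2 * l ^+ 4 * s ^+ 2 -
  7 / 2 * l ^+ 5 * s ^+ 2 + 1 / 2 * l ^+ 6 * s ^+ 2).
exists (g - 25 / 3 * b * l * s + 59 / 6 * b * l ^+ 2 * s - 4 * l * s ^+ 3 - 8
  / 3 * b * l ^+ 3 * s - 2 * l ^+ 2 * s ^+ 3 + 1 / 6 * b * l ^+ 4 * s + 10 * l
  ^+ 3 * s ^+ 3 + 15 / 2 * l ^+ 4 * s ^+ 3 - 73 / 2 * l ^+ 5 * s ^+ 3 + 43 * l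
  ^+ 6 * s ^+ 3 - 23 * l ^+ 7 * s ^+ 3 + 11 / 2 * l ^+ 8 * s ^+ 3 - 1 / 2 * l
  ^+ 9 * s ^+ 3).
rewrite /a in fr; change_basis fr (
  [:: [:: 1 @ 1; s @ 2];
      [:: 1 @ 2; s + l * s @ 3; l * s ^+ 2 + l ^+ 2 * s ^+ 2 - l ^+ 3 * s ^+ 2
        @ 4; b * s + 3 / 2 * l ^+ 2 * s ^+ 3 - 2 * l ^+ 3 * s ^+ 3 + 1 / 2 * l
        ^+ 4 * s ^+ 3 @ 5; g * s + 2 * b * s ^+ 2 - b * l * s ^+ 2 - 11 / 12 *
        l ^+ 4 * s ^+ 4 + 7 / 3 * l ^+ 5 * s ^+ 4 - 2 * l ^+ 6 * s ^+ 4 + 2 /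
        3 * l ^+ 7 * s ^+ 4 - 1 / 12 * l ^+ 8 * s ^+ 4 @ 6];
      [:: 1 @ 3; 2 * s + 2 * l * s - l ^+ 2 * s @ 4; 5 * l * s ^+ 2 + 2 * l ^+
        2 * s ^+ 2 - 15 / 2 * l ^+ 3 * s ^+ 2 + 4 * l ^+ 4 * s ^+ 2 - 1 / 2 *
        l ^+ 5 * s ^+ 2 @ 5; 4 * b * s - 5 * b * l * s + b * l ^+ 2 * s + 38 /
        3 * l ^+ 2 * s ^+ 3 - 41 / 2 * l ^+ 3 * s ^+ 3 + 19 / 6 * l ^+ 4 * s
        ^+ 3 + 163 / 12 * l ^+ 5 * s ^+ 3 - 71 / 6 * l ^+ 6 * s ^+ 3 + 29 / 6
        * l ^+ 7 * s ^+ 3 - l ^+ 8 * s ^+ 3 + 1 / 12 * l ^+ 9 * s ^+ 3 @ 6];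
      [:: 1 @ 4; 3 * s + 7 / 2 * l * s - 3 * l ^+ 2 * s + 1 / 2 * l ^+ 3 * s @
        5; 14 * l * s ^+ 2 + 13 / 6 * l ^+ 2 * s ^+ 2 - 317 / 12 * l ^+ 3 * s
        ^+ 2 + 47 / 2 * l ^+ 4 * s ^+ 2 - 17 / 2 * l ^+ 5 * s ^+ 2 + 4 / 3 * l
        ^+ 6 * s ^+ 2 - 1 / 12 * l ^+ 7 * s ^+ 2 @ 6];
      [:: 1 @ 5; 4 * s + 16 / 3 * l * s - 35 / 6 * l ^+ 2 * s + 5 / 3 * l ^+ 3
        * s - 1 / 6 * l ^+ 4 * s @ 6];
      [:: 1 @ 6]] : seq (svec F)).
Qed.

Lemma shift2_E l b g t :
  has_frame (tE l 0 b g 0) ->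
  has_frame (tE l 0 (b + 2 * l * (l - 1) * t) g 0).
Proof.
move=> fr; change_basis fr (
  [:: [:: 1 @ 1; t @ 3];
      [:: 1 @ 2; 2 * t @ 4; 2 * l * t ^+ 2 - l ^+ 2 * t ^+ 2 @ 6];
      [:: 1 @ 3; 6 * t - 3 * l * t @ 5];
      [:: 1 @ 4; 12 * t - 10 * l * t + 2 * l ^+ 2 * t @ 6]; [:: 1 @ 5];
      [:: 1 @ 6]] : seq (svec F)).
Qed.

Lemma shift3_E l g t :
  has_frame (tE l 0 0 g 0) ->
  has_frame (tE l 0 0 (g - 3 * l * (l - 1) * (l - 2) * t) 0).
Proof.
move=> fr; change_basis fr (
  [:: [:: 1 @ 1; t @ 4]; [:: 1 @ 2; 3 * t - l * t @ 5];
      [:: 1 @ 3; 12 * t - 12 * l * t + 3 * l ^+ 2 * t @ 6]; [:: 1 @ 4];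
      [:: 1 @ 5]; [:: 1 @ 6]] : seq (svec F)).
Qed.

Lemma shift2_E1 a b g t :
  has_frame (tE 1 a b g (- a)) ->
  has_frame (tE 1 a b (g + a * t) (- a)).
Proof.
move=> fr; change_basis fr (
  [:: [:: 1 @ 1; t @ 3]; [:: 1 @ 2; 2 * t @ 4; t ^+ 2 @ 6];
      [:: 1 @ 3; 3 * t @ 5; - 3 * a * t @ 6]; [:: 1 @ 4; 4 * t @ 6];
      [:: 1 @ 5]; [:: 1 @ 6]] : seq (svec F)).
Qed.

Lemma shift_E1 b g s :
  has_frame (tE 1 0 b g 0) ->
  has_frame (tE 1 0 b (g - b * s) 0).
Proof.
move=> fr; change_basis fr (
  [:: [:: 1 @ 1; s @ 2];
      [:: 1 @ 2; 2 * s @ 3; s ^+ 2 @ 4; b * s @ 5; g * s + b * s ^+ 2 @ 6];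
      [:: 1 @ 3; 3 * s @ 4; 3 * s ^+ 2 @ 5; s ^+ 3 @ 6];
      [:: 1 @ 4; 4 * s @ 5; 6 * s ^+ 2 @ 6]; [:: 1 @ 5; 5 * s @ 6];
      [:: 1 @ 6]] : seq (svec F)).
Qed.

(** Needed when k = - 3 a, where [shift2_E0] leaves g fixed: g then changes by - 6 a^2 s. *)
Lemma shift_E0 a b g k s :
  has_frame (tE 0 a b g k) ->
  has_frame (tE 0 a b (g - a * (9 * a + k) * s + 2 * (3 * a + k) * s ^+ 2) k).
Proof.
move=> fr; change_basis fr (
  [:: [:: 1 @ 1; s @ 2];
      [:: 1 @ 2; s @ 3; a * s @ 4; b * s + 3 / 2 * a * s ^+ 2 @ 5; g * s + 2 *
        b * s ^+ 2 + 1 / 2 * a * k * s ^+ 2 @ 6];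
      [:: 1 @ 3; 2 * s @ 4; 3 * a * s @ 5; 4 * b * s + 2 * a * k * s + 6 * a *
        s ^+ 2 - 2 * k * s ^+ 2 @ 6];
      [:: 1 @ 4; 3 * s @ 5; 9 * a * s + k * s @ 6]; [:: 1 @ 5; 4 * s @ 6];
      [:: 1 @ 6]] : seq (svec F)).
Qed.

Lemma shift2_E0 a b g k t :
  has_frame (tE 0 a b g k) ->
  has_frame (tE 0 a b (g - 4 * (3 * a + k) * t) k).
Proof.
move=> fr; change_basis fr (
  [:: [:: 1 @ 1; t @ 3]; [:: 1 @ 2; 2 * t @ 4];
      [:: 1 @ 3; 6 * t @ 5; 6 * a * t + 6 * k * t @ 6];
      [:: 1 @ 4; 12 * t @ 6]; [:: 1 @ 5]; [:: 1 @ 6]] : seq (svec F)).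
Qed.

Lemma shift_I b g s :
  has_frame (tI (- s) b g) ->
  has_frame (tI 0 (b - 2 * s ^+ 2) (g + 10 * b * s - 6 * s ^+ 3)).
Proof.
move=> fr; change_basis fr (
  [:: [:: 1 @ 1; s @ 2];
      [:: 1 @ 2; s @ 3; - s ^+ 2 @ 4; b * s + s ^+ 3 @ 5; g * s - b * s ^+ 2 -
        5 * s ^+ 4 @ 6];
      [:: 1 @ 3; - s @ 4; 4 * s ^+ 2 @ 5; - 4 * b * s - 22 * s ^+ 3 @ 6];
      [:: 1 @ 4; - 3 * s @ 5; 24 * s ^+ 2 @ 6]; [:: 1 @ 5; - 8 * s @ 6];
      [:: 1 @ 6]] : seq (svec F)).
Qed.

Lemma shift3_I b g t :
  has_frame (tI 0 b g) ->
  has_frame (tI 0 b (g + 3 * t)).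
Proof.
move=> fr; change_basis fr (
  [:: [:: 1 @ 1; t @ 4]; [:: 1 @ 2; t @ 5]; [:: 1 @ 3; - 3 * t @ 6];
      [:: 1 @ 4]; [:: 1 @ 5]; [:: 1 @ 6]] : seq (svec F)).
Qed.

(** The scaling lemmas are read backwards: the conclusion carries the normalised parameters, and the
    given frame has them multiplied by powers of c. *)
Lemma scale_B1 c l m a b : c != 0 ->
  has_frame (tB1 l m (c * a) (c * b)) -> has_frame (tB1 l m a b).
Proof. by move=> c0 fr; change_basis fr (gradBm c). Qed.

Lemma scale_B2 c p a : c != 0 ->
  has_frame (tB2 p (c * a) 0) -> has_frame (tB2 p a 0).
Proof. by move=> c0 fr; change_basis fr (gradBm c). Qed.

Lemma scale_B3 c q r l : c != 0 ->
  has_frame (tB3 (c * q) (c * r) l) -> has_frame (tB3 q r l).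
Proof. by move=> c0 fr; change_basis fr (gradBm c). Qed.

Lemma scale_B4 c q r : c != 0 ->
  has_frame (tB4 (c * q) (c * r)) -> has_frame (tB4 q r).
Proof. by move=> c0 fr; change_basis fr (gradBm c). Qed.

Lemma scale_D c a b g : c != 0 ->
  has_frame (tD (c * a) (c ^+ 2 * b) (c ^+ 2 * g)) -> has_frame (tD a b g).
Proof. by move=> c0 fr; change_basis fr (gradDm c). Qed.

Lemma scale_E c l a b g k : c != 0 ->
  has_frame (tE l (c * a) (c ^+ 2 * b) (c ^+ 3 * g) (c * k)) -> has_frame (tE
    l a b g k).
Proof. by move=> c0 fr; change_basis fr (gradm c). Qed.

Lemma scale_I c b g : c != 0 ->
  has_frame (tI 0 (c ^+ 2 * b) (c ^+ 3 * g)) -> has_frame (tI 0 b g).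
Proof. by move=> c0 fr; change_basis fr (gradm c). Qed.

End Changes.

Ltac encode_row :=
  lazymatch goal with
  | |- row_expr (e _ _) _ => apply: RowE
  | |- row_expr (_ + _) _ => apply: RowD; encode_row
  | |- row_expr (_ *: _) _ => apply: RowZ; encode_row
  | |- row_expr (- _) _ => apply: RowN; encode_row
  end.

Ltac encode :=
  lazymatch goal with
  | |- encodes [::] _ => exact: EncNil
  | |- encodes (_ :: _) _ => apply: EncCons; [encode_row | encode]
  | |- encodes ?t _ => let h := eval hnf in t in change t with h; encode
  end.

(** * Reduction of the parameters to the list *)

Section Classify.
Variables (F : numClosedFieldType) (V : vectType F).
Variable mul : {bilinear V -> V -> V}.
Hypotheses (dimV : \dim {:V} = 6%N).
Hypotheses (nov : novikov mul) (nilp : nilpotent mul).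
Implicit Types a b c g k l m p q s r : F.
Local Notation has_frame := (has_frame mul).
Local Notation classified := (classified mul).

Ltac to_table fr lt M :=
  eapply (listed_frame (M := M) dimV nilp fr lt);
  [encode | by [] | by split=> //; exact: oner_neq0 | check_table].

Lemma same_frame T1 T2 : has_frame T1 -> T1 = T2 -> has_frame T2.
Proof. by move=> + <-. Qed.

Lemma classify_A1 : has_frame (tA1 F) -> classified.
Proof. by move=> fr; to_table fr (Listed01 F) (idm F). Qed.

Lemma classify_A2 l : has_frame (tA2 l) -> classified.
Proof. by move=> fr; to_table fr (Listed02 l) (idm F). Qed.

Lemma classify_A3 l m : has_frame (tA3 l m) -> classified.
Proof. by move=> fr; to_table fr (Listed03 l m) (idm F). Qed.

(** The shift by s e_2 moves b unless m is 1 or 2. It moves a by 9 s if m = 2 and by 2 (1 - l) s if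
    m = 1. Hence only l = m = 1 resists; there scaling leaves the ratio a / b, the parameter of
    [N23]. *)
Lemma classify_B1 l m a b : has_frame (tB1 l m a b) -> classified.
Proof.
move=> fr; case: (eqVneq m 2) fr => [-> fr|m2 fr].
  have {}fr : has_frame (tB1 l 2 0 b).
    by apply: (same_frame (shift_B1 nilp (- a / 9) fr)); congr (tB1 _ _ _ _);
      field.
  case: (eqVneq b 0) fr => [-> fr|b0 fr]; first by to_table fr (Listed20 l 2)
    (idm F).
  (* Here e_1 e_5 = 3 e_6 whereas [N24] has coefficient 1; tripling e_6 corrects this and turns b =
     3 into 1. *)
  have {}fr : has_frame (tB1 l 2 0 3).
    apply: (scale_B1 nilp (c := b / 3)).
      by rewrite mulf_neq0 // invr_eq0 pnatr_eq0.
    by apply: (same_frame fr); congr (tB1 _ _ _ _); field.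
  by to_table fr (Listed24 l) ([:: [:: 1 @ 1]; [:: 1 @ 2]; [:: 1 @ 3];
      [:: 1 @ 4]; [:: 1 @ 5]; [:: 3 @ 6]] : seq (svec F)).
case: (eqVneq m 1) fr => [-> fr|m1 fr]; last first.
  have m2' : m - 2 != 0 by rewrite subr_eq0.
  have m1' : m - 1 != 0 by rewrite subr_eq0.
  have {a b fr} [a fr] : exists a, has_frame (tB1 l m a 0).
    pose s := - b / ((m - 1) * (m - 2) ^+ 2).
    exists (a + s * ((m + 1) * (l * (m - 2) + 2 * m - 1))).
    apply: (same_frame (shift_B1 nilp s fr)); congr (tB1 _ _ _ _); rewrite /s.
    by field; rewrite m1' m2'.
  case: (eqVneq a 0) fr => [-> fr|a0 fr]; first by to_table fr (Listed20 l m)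
    (idm F).
  have {}fr : has_frame (tB1 l m 1 0).
    by apply: (scale_B1 nilp a0); apply: (same_frame fr); congr (tB1 _ _ _ _);
      ring.
  by to_table fr (Listed21 l m2) (idm F).
have {m2} m2 : (1 : F) != 2.
  by rewrite eq_sym -subr_eq0 (_ : 2 - 1 = 1) ?oner_neq0 //; ring.
case: (eqVneq l 1) fr => [-> fr|l1 fr]; last first.
  have l1' : l - 1 != 0 by rewrite subr_eq0.
  have {}fr : has_frame (tB1 l 1 0 b).
    by apply: (same_frame (shift_B1 nilp (a / (2 * (l - 1))) fr)); congr (tB1
      _ _ _ _); field.
  case: (eqVneq b 0) fr => [-> fr|b0 fr]; first by to_table fr (Listed20 l 1)
    (idm F).
  have {}fr : has_frame (tB1 l 1 0 1).
    by apply: (scale_B1 nilp b0); apply: (same_frame fr); congr (tB1 _ _ _ _);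
      ring.
  by to_table fr (Listed22 l) (idm F).
case: (eqVneq b 0) fr => [-> fr|b0 fr].
  case: (eqVneq a 0) fr => [-> fr|a0 fr].
    by to_table fr (Listed20 (1 : F) 1) (idm F).
  have {}fr : has_frame (tB1 1 1 1 0).
    by apply: (scale_B1 nilp a0); apply: (same_frame fr); congr (tB1 _ _ _ _);
      ring.
  by to_table fr (Listed21 1 m2) (idm F).
have {}fr : has_frame (tB1 1 1 (a / b) 1).
  apply: (scale_B1 nilp b0).
  by apply: (same_frame fr); congr (tB1 _ _ _ _); field.
case: (eqVneq (a / b) 0) fr => [-> fr|n0 fr].
  by to_table fr (Listed22 (1 : F)) (idm F).
by to_table fr (Listed23 n0) (idm F).
Qed.

Lemma classify_B2 p a c : has_frame (tB2 p a c) -> classified.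
Proof.
move=> fr; have {a c fr} [a fr] : exists a, has_frame (tB2 p a 0).
  eexists; apply: (shift_B2 nilp (s := - c)); rewrite opprK; exact: fr.
case: (eqVneq p 0) fr => [-> fr|p0 fr].
  case: (eqVneq a 0) fr => [-> fr|a0 fr].
    by to_table fr (Listed04 F) ([:: [:: 1 @ 1]; [:: 1 @ 2]; [:: 1 @ 4];
      [:: 1 @ 5]; [:: 1 @ 3]; [:: - 1 @ 6]] : seq (svec F)).
  have {}fr : has_frame (tB2 0 (-1) 0).
    apply: (scale_B2 nilp (c := - a)); first by rewrite oppr_eq0.
    by apply: (same_frame fr); congr (tB2 _ _ _); ring.
  by to_table fr (Listed13 F) ([:: [:: 1 @ 1]; [:: 1 @ 2]; [:: 1 @ 4];
      [:: 1 @ 3]; [:: 1 @ 5]; [:: - 1 @ 6]] : seq (svec F)).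
have ip0 : p^-1 != 0 by rewrite invr_eq0.
case: (eqVneq a 0) fr => [-> fr|a0 fr].
  by to_table fr (Listed25 ip0) ([:: [:: 1 @ 1]; [:: 1 @ 2]; [:: 1 @ 3];
      [:: 1 @ 4]; [:: p @ 5]; [:: p @ 6]] : seq (svec F)).
(* With e_5' = e_1 e_3 and e_6' = p e_6, this value of a gives e_1 e_4 = e_5' / p + e_6', as in
   [N26] at 1 / p. *)
have {}fr : has_frame (tB2 p (- p ^+ 2) 0).
  apply: (scale_B2 nilp (c := - a / p ^+ 2)).
    by rewrite mulf_neq0 ?oppr_eq0 // invr_eq0 expf_neq0.
  by apply: (same_frame fr); congr (tB2 _ _ _); field.
by to_table fr (Listed26 ip0) ([:: [:: 1 @ 1]; [:: 1 @ 2]; [:: 1 @ 3];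
    [:: 1 @ 4]; [:: p @ 5; - p ^+ 2 @ 6]; [:: p @ 6]] : seq (svec F)).
Qed.

Lemma classify_B3 q c l : has_frame (tB3 q c l) -> classified.
Proof.
move=> fr; case: (eqVneq c 0) fr => [-> fr|c0 fr].
  case: (eqVneq q 0) fr => [-> fr|q0 fr].
    by to_table fr (Listed06 l) ([:: [:: 1 @ 1]; [:: 1 @ 2]; [:: 1 @ 3];
      [:: 1 / 2 @ 5]; [:: 1 / 2 @ 6]; [:: 1 @ 4]] : seq (svec F)).
  have {}fr : has_frame (tB3 (1 / 2) 0 l).
    apply: (scale_B3 nilp (c := 2 * q)); first by rewrite mulf_neq0 ?pnatr_eq0.
    by apply: (same_frame fr); congr (tB3 _ _ _); field.
  by to_table fr (Listed17 l) (halvesm F).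
have {}fr : has_frame (tB3 (q / c / 2) (1 / 2) l).
  apply: (scale_B3 nilp (c := 2 * c)); first by rewrite mulf_neq0 ?pnatr_eq0.
  by apply: (same_frame fr); congr (tB3 _ _ _); field.
by to_table fr (Listed19 (q / c - 2) l) (halvesm F).
Qed.

Lemma classify_B4 q c : has_frame (tB4 q c) -> classified.
Proof.
move=> fr; case: (eqVneq c 0) fr => [-> fr|c0 fr].
  case: (eqVneq q 0) fr => [-> fr|q0 fr].
    by to_table fr (Listed05 (0 : F)) ([:: [:: 1 @ 1]; [:: 1 @ 2]; [:: 1 @ 3];
      [:: 1 / 2 @ 5]; [:: 1 / 6 @ 6]; [:: 1 @ 4]] : seq (svec F)).
  have {}fr : has_frame (tB4 (1 / 6) 0).
    apply: (scale_B4 nilp (c := 6 * q)); first by rewrite mulf_neq0 ?pnatr_eq0.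
    by apply: (same_frame fr); congr (tB4 _ _); field.
  have n3 : (0 : F) != 3 by rewrite eq_sym pnatr_eq0.
  by to_table fr (Listed16 n3) ([:: [:: 1 @ 1]; [:: 1 @ 2]; [:: 1 @ 3];
      [:: 1 @ 4]; [:: 1 / 2 @ 5]; [:: 1 / 6 @ 6]] : seq (svec F)).
have {}fr : has_frame (tB4 (q / c / 2) (1 / 2)).
  apply: (scale_B4 nilp (c := 2 * c)); first by rewrite mulf_neq0 ?pnatr_eq0.
  by apply: (same_frame fr); congr (tB4 _ _); field.
by to_table fr (Listed18 (q / c - 2)) (halvesm F).
Qed.

(** Brings a nonzero parameter of weight n to any prescribed nonzero value. *)
Lemma root_scale n a b : (0 < n)%N -> a != 0 -> b != 0 ->
  exists2 c, c != 0 & c ^+ n * b = a.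
Proof.
move=> n0 a0 b0; exists (n.-root (a / b)); last by rewrite rootCK // divfK.
by rewrite rootC_eq0 // mulf_neq0 ?invr_eq0.
Qed.

Lemma classify_D a b c : has_frame (tD a b c) -> classified.
Proof.
move=> fr; case: (eqVneq a 0) fr => [-> fr|a0 fr].
  have {}fr : has_frame (tD 0 b 0).
    by apply: (same_frame (shift_D nilp (- c / 2) fr)); congr (tD _ _ _); field.
  case: (eqVneq b 0) fr => [-> fr|b0 fr].
    by to_table fr (Listed08 F) ([:: [:: 1 @ 1]; [:: 1 @ 2]; [:: 1 @ 3];
      [:: 1 / 2 @ 4]; [:: 1 / 2 @ 5]; [:: 1 / 2 @ 6]] : seq (svec F)).
  have h2 : 1 / 2 != 0 :> F by rewrite mul1r invr_eq0 pnatr_eq0.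
  have [d d0 db] := root_scale (isT : (0 < 2)%N) b0 h2.
  have {}fr : has_frame (tD 0 (1 / 2) 0).
    by apply: (scale_D nilp d0); rewrite db; apply: (same_frame fr); congr (tD
      _ _ _); ring.
  by to_table fr (Listed07 F) ([:: [:: 1 @ 1]; [:: 1 @ 2]; [:: 1 @ 3];
    [:: 1 / 2 @ 4]; [:: 1 / 2 @ 5]; [:: 1 / 2 @ 6]] : seq (svec F)).
have {}fr : has_frame (tD (1 / 2) (b / (2 * a) ^+ 2) (c / (2 * a) ^+ 2)).
  have a2 : 2 * a != 0 by rewrite mulf_neq0 ?pnatr_eq0.
  apply: (scale_D nilp a2).
  by apply: (same_frame fr); congr (tD _ _ _); field.
move: fr; move: (b / _) (c / _) => {}b {}c fr.
(* For equal parameters e_1 e_3 - 2 e_2 e_1 is a multiple of e_5 + e_6, hence of e_2 e_2, as [N11]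
   demands. *)
have {}fr : has_frame (tD (1 / 2) b b).
  by apply: (same_frame (shift_D nilp ((b - c) / 2) fr)); congr (tD _ _ _);
    field.
by to_table fr (Listed11 (- 8 * b)) ([:: [:: 1 @ 1]; [:: 1 @ 2]; [:: 1 @ 3];
  [:: 1 / 2 @ 4; b @ 5; b @ 6]; [:: - 1 / 2 @ 6]; [:: 1 / 4 @ 5; 1 / 4 @ 6]]
    : seq (svec F)).
Qed.

Lemma classify_I a b g : has_frame (tI a b g) -> classified.
Proof.
move=> fr; have {a b g fr} [b [g fr]] : exists b g, has_frame (tI 0 b g).
  by do 2!eexists; apply: (shift_I nilp (s := - a)); rewrite opprK; exact: fr.
have {}fr : has_frame (tI 0 b 0).
  by apply: (same_frame (shift3_I nilp (- g / 3) fr)); congr (tI _ _ _); field.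
case: (eqVneq b 0) fr => [-> fr|b0 fr]; first by to_table fr (Listed27 F) (idm
  F).
have [d d0 db] := root_scale (isT : (0 < 2)%N) b0 (oner_neq0 F).
have {}fr : has_frame (tI 0 1 0).
  by apply: (scale_I nilp d0); rewrite db; apply: (same_frame fr); congr (tI _
    _ _); ring.
by to_table fr (Listed28 F) (idm F).
Qed.

Lemma classify_E0 a b g k : has_frame (tE 0 a b g k) -> classified.
Proof.
have n2 : (2 : F) != 0 by rewrite pnatr_eq0.
have n4 : (4 : F) != 0 by rewrite pnatr_eq0.
have n6 : (6 : F) != 0 by rewrite pnatr_eq0.
move=> fr; case: (eqVneq a 0) fr => [-> fr|a0 fr].
  case: (eqVneq k 0) fr => [-> fr|k0 fr].
    case: (eqVneq b 0) fr => [-> fr|b0 fr].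
      case: (eqVneq g 0) fr => [-> fr|g0 fr].
        by to_table fr (Listed29 (0 : F)) (idm F).
      have [d d0 dg] := root_scale (isT : (0 < 3)%N) g0 n4.
      have {}fr : has_frame (tE 0 0 0 4 0).
        apply: (scale_E nilp d0); rewrite dg.
        by apply: (same_frame fr); congr (tE _ _ _ _ _); ring.
      by to_table fr (Listed32 F) ([:: [:: 1 @ 1]; [:: 1 @ 2]; [:: 1 @ 3];
        [:: 1 @ 4]; [:: 1 @ 5]; [:: 4 @ 6]] : seq (svec F)).
    have [d d0 db] := root_scale (isT : (0 < 2)%N) b0 n6.
    have {}fr : has_frame (tE 0 0 6 (g / d ^+ 3) 0).
      apply: (scale_E nilp d0); rewrite db.
      by apply: (same_frame fr); congr (tE _ _ _ _ _); field.
    by to_table fr (Listed34 (g / d ^+ 3 / 12)) ([:: [:: 1 @ 1]; [:: 1 @ 2];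
      [:: 1 @ 3]; [:: 2 @ 4; - 12 @ 6]; [:: 6 @ 5]; [:: 12 @ 6]] : seq (svec
        F)).
  (* At a = 0 and nonzero k, adding t e_3 to the generator gives g any desired value. *)
  have kill g' h k' : k' != 0 -> has_frame (tE 0 0 b g' k') ->
      has_frame (tE 0 0 b h k').
    move=> k0' fr'.
    apply: (same_frame (shift2_E0 nilp ((g' - h) / (4 * k')) fr')).
    by congr (tE _ _ _ _ _); field.
  case: (eqVneq b 0) kill fr => [-> kill fr|b0 kill fr].
    have {}fr : has_frame (tE 0 0 0 0 (- 4)).
      apply: (scale_E nilp (c := - k / 4)).
        by rewrite mulf_neq0 ?oppr_eq0 ?invr_eq0.
      apply: (same_frame (kill g 0 k k0 fr)).
      by congr (tE _ _ _ _ _); field.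
    by to_table fr (Listed31 F) ([:: [:: 1 @ 1]; [:: 1 @ 2]; [:: 1 @ 3];
      [:: 1 @ 4]; [:: 1 @ 5; - 8 / 3 @ 6]; [:: 4 @ 6]] : seq (svec F)).
  have [d d0 db] := root_scale (isT : (0 < 2)%N) b0 n6.
  (* This g makes e_2 e_1 equal to e_1 (e_1 e_3), both being e_5 in [N35]. *)
  have {}fr : has_frame (tE 0 0 6 (4 * (k / d)) (k / d)).
    apply: (scale_E nilp d0); rewrite db.
    apply: (same_frame (kill g (4 * k * d ^+ 2) k k0 fr)).
    by congr (tE _ _ _ _ _); field.
  have l0 : - (k / d) / 6 != 0.
    by rewrite !mulf_neq0 ?oppr_eq0 ?invr_eq0 ?mulf_neq0 ?invr_eq0.
  by to_table fr (Listed35 l0) ([:: [:: 1 @ 1]; [:: 1 @ 2]; [:: 1 @ 3];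
    [:: 2 @ 4; - 12 @ 6]; [:: 6 @ 5; 4 * (k / d) @ 6]; [:: 12 @ 6]] : seq
      (svec F)).
have {}fr : has_frame (tE 0 1 (b / a ^+ 2) (g / a ^+ 3) (k / a)).
  apply: (scale_E nilp a0).
  by apply: (same_frame fr); congr (tE _ _ _ _ _); field.
move: fr; move: (b / _) (g / _) (k / _) => {}b {}g {}k fr.
(* The value of g for which e_1 e_3 - 2 e_2 e_1 is a multiple of e_2 e_2, as in [N37]. *)
have {}fr : has_frame (tE 0 1 b (b * (4 * b + k) / 3) k).
  case: (eqVneq k (- 3)) fr => [-> fr|k3 fr].
    apply: (same_frame (shift_E0 nilp ((g - b * (4 * b - 3) / 3) / 6) fr)).
    by congr (tE _ _ _ _ _); field.
  have k3' : k + 3 != 0 by rewrite -[3]opprK subr_eq0.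
  apply: (same_frame (shift2_E0 nilp ((g - b * (4 * b + k) / 3) / (4 * (k +
    3))) fr)).
  congr (tE _ _ _ _ _); field; exact: k3'.
by to_table fr (Listed37 (- 4 / 3 * b - 1) (k / 6)) ([:: [:: 1 @ 1]; [:: 1 @ 2];
  [:: 1 @ 3]; [:: 1 @ 4; b @ 5; b * (4 * b + k) / 3 @ 6];
  [:: 3 / 2 @ 5; 2 * b + k / 2 @ 6]; [:: 6 @ 6]] : seq (svec F)).
Qed.

Lemma classify_E1 a b g : has_frame (tE 1 a b g (- a)) -> classified.
Proof.
move=> fr; case: (eqVneq a 0) fr => [-> fr|a0 fr]; last first.
  have {}fr : has_frame (tE 1 1 (b / a ^+ 2) (g / a ^+ 3) (- 1)).
    apply: (scale_E nilp a0).
    by apply: (same_frame fr); congr (tE _ _ _ _ _); field.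
  move: fr; move: (b / _) (g / _) => {}b {}g fr.
  (* The value of g for which e_2 e_1 - e_3 - e_2 e_2 is a multiple of e_3 e_2, as in [N38]. *)
  have {}fr : has_frame (tE 1 1 b (2 * b - 3 / 2) (- 1)).
    apply: (same_frame (shift2_E1 nilp (2 * b - 3 / 2 - g) fr)).
    by congr (tE _ _ _ _ _); field.
  by to_table fr (Listed38 (b - 1)) ([:: [:: 1 @ 1]; [:: 1 @ 2]; [:: 1 @ 3];
    [:: 1 @ 4; 1 @ 5; b - 1 / 2 @ 6]; [:: 1 @ 5; 1 @ 6]; [:: 1 @ 6]]
      : seq (svec F)).
rewrite oppr0 in fr.
case: (eqVneq b 0) fr => [-> fr|b0 fr].
  case: (eqVneq g 0) fr => [-> fr|g0 fr].
    by to_table fr (Listed29 (1 : F)) (idm F).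
  have [d d0 dg] := root_scale (isT : (0 < 3)%N) g0 (oner_neq0 F).
  have {}fr : has_frame (tE 1 0 0 1 0).
    apply: (scale_E nilp d0); rewrite dg.
    by apply: (same_frame fr); congr (tE _ _ _ _ _); ring.
  by to_table fr (Listed33 F) (idm F).
have [d d0 db] := root_scale (isT : (0 < 2)%N) b0 (oner_neq0 F).
have {}fr : has_frame (tE 1 0 1 0 0).
  apply: (scale_E nilp d0); rewrite db.
  apply: (same_frame (shift_E1 nilp (g / b) fr)).
  by congr (tE _ _ _ _ _); field.
by to_table fr (Listed36 F) ([:: [:: 1 @ 1]; [:: 1 @ 2]; [:: 1 @ 3];
  [:: 1 @ 4; 1 @ 6]; [:: 1 @ 5]; [:: 1 @ 6]] : seq (svec F)).
Qed.

(** Away from l = 0 and l = 1, adding multiples of e_2, e_3 and e_4 to the generator removes a, b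
    and g in turn; the last step fails at l = 2, which leaves [N30]. *)
Lemma classify_E l a b g k : l * (k - kE l a) = 0 ->
  has_frame (tE l a b g k) -> classified.
Proof.
case: (eqVneq l 0) => [-> _|l0]; first exact: classify_E0.
move=> /eqP; rewrite mulf_eq0 (negPf l0) subr_eq0 /= => /eqP-> {k}.
case: (eqVneq l 1) => [-> fr|l1 fr].
  apply: (@classify_E1 a b g); apply: (same_frame fr).
  by congr (tE _ _ _ _ _); rewrite /kE; field.
have l1' : 1 - l != 0 by rewrite subr_eq0 eq_sym.
have l1'' : l - 1 != 0 by rewrite subr_eq0.
have {a b g fr} [b [g fr]] : exists b g, has_frame (tE l 0 b g 0).
  apply: (shift_E nilp (b := b) (g := g) (s := a / (l ^+ 2 * (1 - l)))).
  by rewrite mulrC divfK ?mulf_neq0 ?expf_neq0.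
have {b fr} fr : has_frame (tE l 0 0 g 0).
  apply: (same_frame (shift2_E nilp (- b / (2 * l * (l - 1))) fr)).
  by congr (tE _ _ _ _ _); field; rewrite l0 l1''.
case: (eqVneq l 2) fr => [-> fr|l2 fr]; last first.
  have l2' : l - 2 != 0 by rewrite subr_eq0.
  have {}fr : has_frame (tE l 0 0 0 0).
    apply: (same_frame (shift3_E nilp (g / (3 * l * (l - 1) * (l - 2))) fr)).
    by congr (tE _ _ _ _ _); field; rewrite l0 l1'' l2'.
  by to_table fr (Listed29 l) (idm F).
case: (eqVneq g 0) fr => [-> fr|g0 fr].
  by to_table fr (Listed29 (2 : F)) (idm F).
have [d d0 dg] := root_scale (isT : (0 < 3)%N) g0 (oner_neq0 F).
have {}fr : has_frame (tE 2 0 0 1 0).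
  apply: (scale_E nilp d0); rewrite dg.
  by apply: (same_frame fr); congr (tE _ _ _ _ _); ring.
by to_table fr (Listed30 F) (idm F).
Qed.

End Classify.

(* Proves an equality of linear combinations of the vectors of the list l     *)
(* (at most six, the range of indices) by comparing coefficients.             *)
Ltac find_atom x l :=
  match l with
  | ?y :: _ => let _ := match goal with _ => unify x y end in constr:(1%N)
  | _ :: ?l' => let n := find_atom x l' in constr:(n.+1)
  end.

Ltac reify_vec F l x :=
  lazymatch x with
  | 0 => constr:(@nil (nat * F))
  | ?y + ?z => let s := reify_vec F l y in let t := reify_vec F l z in
      constr:(sapp s t)
  | - ?y => let s := reify_vec F l y in constr:(sscale (-1 : F) s)
  | ?c *: ?y => let s := reify_vec F l y in constr:(sscale (c : F) s)
  | _ => let n := find_atom x l in constr:([:: (n, 1 : F)])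
  end.

Ltac module F l :=
  rewrite ?(scaler0, oppr0, addr0, add0r);
  match goal with |- ?x = ?y =>
    let s := reify_vec F l x in let t := reify_vec F l y in
    let v := constr:(nth 0 (0 :: l)) in
    transitivity (eval v s);
    [by rewrite ?(eval_nil, eval_basis, eval_app, eval_scale) ?scaleN1r
    |transitivity (eval v t);
    [apply: seqv_eval; [by []|by []|]
    |by rewrite ?(eval_nil, eval_basis, eval_app, eval_scale) ?scaleN1r]]
  end;
  cbv [forall_in indices seqv sapp sscale scoef eqn]; repeat split; try by
    field.

Ltac products :=
  cbv [forall_in indices tA1 tA2 tA3 tB1 tB2 tB3 tB4 tD tE tI entry eqn sapp
    nth predn];
  rewrite ?eval_cons ?eval_nil; repeat split.

Ltac finish F rules atoms :=
  products; rewrite ?rules; module F atoms.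

Ltac expand := rewrite ?(linearDl, linearDr, linearNl, linearNr, linearZl_LR,
  linearZr_LR) /=.

Section LinearAlgebra.
Variables (F : fieldType) (V : vectType F).
Implicit Types (x y z : V) (U W : {vspace V}).

Lemma dimv_line_le x : (\dim <[x]> <= 1)%N.
Proof. by rewrite dim_vline leq_b1. Qed.

Lemma dimv_add_line x U : x \notin U -> \dim (<[x]> + U) = (\dim U).+1.
Proof.
move=> xU; rewrite dimv_disjoint_sum.
  by rewrite dim_vline (contraNneq _ xU) // => ->; rewrite mem0v.
apply/eqP; rewrite -subv0; apply/subvP => y; rewrite memv_cap memv0.
case/andP=> /vlineP[c ->]; case: (eqVneq c 0) => [->|c0]; first by rewrite
  scale0r.
by move=> cx; case/negP: xU; rewrite -[x](scalerK c0); apply: memvZ.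
Qed.

Lemma memv_line_add x U y : y \in (<[x]> + U)%VS -> exists c, y - c *: x \in U.
Proof.
by case/memv_addP=> _ /vlineP[c ->] [u uU ->]; exists c; rewrite addrAC subrr
  add0r.
Qed.

Lemma vline_of_dim U x : (\dim U <= 1)%N -> x \in U -> x != 0 -> (U <=
  <[x]>)%VS.
Proof.
move=> dU xU x0; have : (\dim U <= \dim <[x]>)%N by rewrite dim_vline x0.
by rewrite (geq_leqif (dimv_leqif_sup _)) -?memvE.
Qed.

End LinearAlgebra.

(** * Relations between words in the generator *)

Section Structure.
Variables (F : numClosedFieldType) (V : vectType F).
Variable mul : {bilinear V -> V -> V}.
Hypotheses (dimV : \dim {:V} = 6%N).
Hypotheses (nov : novikov mul) (nilp : nilpotent mul).
Variable a : V.
Hypothesis ga : generates mul a.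
Local Notation "x · y" := (mul x y) (at level 40, left associativity).
Local Notation P := (pw mul).
Implicit Types x y z : V.

(* [R, [R, L]] = 0 for the multiplications L and R by [a]; this is the        *)
(* commutation of R with the right multiplication by [a a].                   *)
Lemma heisenberg z :
  (a · z) · a · a - 2 *: ((a · (z · a)) · a) + a · (z · a · a) = 0.
Proof.
have h y : y · (a · a) = (y · a) · a - (a · y) · a + a · (y · a).
  exact: mulr_mul.
have := mulAC nov z (a · a) a; rewrite !h !linearDl /= !linearNl /=.
set p := _ · _ · _ · _; set q := _ · _ · _; set r := a · _ · _ => e.
transitivity ((q · a - r + a · q) - (q · a - p + r)); last by rewrite e subrr.
by module F [:: p; r; a · q; q · a].
Qed.

(** By right commutativity (u w) y = (u y) w, which raises the degree of y twice; on the other side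
    the formula for R_{xy} does the same. *)
Lemma pw2_mull k x y : (0 < k)%N -> x \in P 2 -> y \in P k -> x · y \in P k.+2.
Proof.
move=> k0 x2 yk; have : (P 2 <= linfun (applyr mul y) @^-1: P k.+2)%VS.
  have h u w : u · w · y \in P k.+2.
    by rewrite (mulAC nov); apply: pwMr => //; apply: pwMl.
  by apply: pw_subP => // u w _; rewrite -memv_preim lfunE; apply: h.
by move=> /subvP/(_ x x2); rewrite -memv_preim lfunE.
Qed.

Lemma pw2_mulr k x y : (0 < k)%N -> x \in P 2 -> y \in P k -> y · x \in P k.+2.
Proof.
move=> k0 x2 yk; have : (P 2 <= linfun (mul y) @^-1: P k.+2)%VS.
  have h u w : y · (u · w) \in P k.+2.
    rewrite (mulr_mul nov); apply: memvD; last by apply: pwMl => //; apply: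
      pwMr.
    by apply: memvB; apply: pwMr => //; [apply: pwMr|apply: pwMl].
  by apply: pw_subP => // u w _; rewrite -memv_preim lfunE; apply: h.
by move=> /subvP/(_ x x2); rewrite -memv_preim lfunE.
Qed.

(** Every element is c a + t with t in V^2, and multiplication by t sends V^k into V^(k+2); so
    modulo V^(k+2) only products with a matter. *)
Lemma pw_next k (W X : {vspace V}) : (0 < k)%N -> (P k <= W + P k.+1)%VS ->
  (forall w, w \in W -> a · w \in X /\ w · a \in X) ->
  (P k.+2 <= X)%VS -> (P k.+1 <= X)%VS.
Proof.
move=> k0 kW WX /subvP kX.
have dec s : exists c, exists2 t, t \in P 2 & s = c *: a + t.
  have := memvf s; rewrite -(generates_full ga).
  by case/memv_addP=> _ /vlineP[c ->] [t t2 ->]; exists c, t.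
apply: pw_subP => // s y.
  move=> yk; have /memv_addP[w wW [z zk ey]] := subvP kW y yk.
  have [c [t t2 ->]] := dec s.
  rewrite linearDl linearZl_LR; apply: memvD; last exact/kX/pw2_mull.
  rewrite ey linearDr; apply/memvZ/memvD; first exact: (proj1 (WX _ wW)).
  by apply/kX/pwMl.
move=> sk; have /memv_addP[w wW [z zk ey]] := subvP kW s sk.
have [c [t t2 ->]] := dec y.
rewrite linearDr linearZr_LR; apply: memvD; last exact/kX/pw2_mulr.
rewrite ey linearDl; apply/memvZ/memvD; first exact: (proj2 (WX _ wW)).
by apply/kX/pwMr.
Qed.

Lemma pw_next_line k x : (0 < k)%N -> (P k <= <[x]> + P k.+1)%VS ->
  (P k.+1 <= <[a · x]> + <[x · a]> + P k.+2)%VS.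
Proof.
move=> k0 kx; apply: (pw_next k0 kx); last exact: addvSr.
have s1 : (<[a · x]> <= <[a · x]> + <[x · a]> + P k.+2)%VS.
  by rewrite -addvA addvSl.
have s2 : (<[x · a]> <= <[a · x]> + <[x · a]> + P k.+2)%VS.
  exact: (subv_trans (addvSr _ _) (addvSl _ _)).
move=> w /vlineP[c ->]; split.
  by rewrite linearZr_LR; apply: memvZ; rewrite memvE.
by rewrite linearZl_LR; apply: memvZ; rewrite memvE.
Qed.

Lemma pw_next_line1 k x v : (0 < k)%N -> (P k <= <[x]> + P k.+1)%VS ->
  a · x \in (<[v]> + P k.+2)%VS -> x · a \in (<[v]> + P k.+2)%VS ->
  (P k.+1 <= <[v]> + P k.+2)%VS.
Proof.
move=> k0 kx ax xa; apply: (subv_trans (pw_next_line k0 kx)).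
by rewrite subv_add addvSr andbT subv_add -!memvE ax xa.
Qed.

Lemma dim_pw_line k x : (P k <= <[x]> + P k.+1)%VS ->
  (\dim (P k) <= (\dim (P k.+1)).+1)%N.
Proof.
move=> /dimvS h; apply: (leq_trans h); apply: (leq_trans (dimv_add_leqif _ _)).
by rewrite -[X in (_ <= X)%N]add1n leq_add2r dimv_line_le.
Qed.

Lemma has_frame_words (s : seq V) t ws :
  nth 0 s 0 = a -> stwf t -> words_wf 2 ws -> generated_by t ws ->
  forall_in indices (fun j =>
    a · nth 0 s j.-1 = eval (fun i => nth 0 s i.-1) (entry t 1 j)) ->
  forall_in indices (fun j =>
    nth 0 s j.-1 · a = eval (fun i => nth 0 s i.-1) (entry t j 1)) ->
  has_frame mul t.
Proof.
move=> sa wt ww gt /forall_in_iff hl /forall_in_iff hr.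
exists (fun i => nth 0 s i.-1); apply: (framed_words nov) ww gt => //=.
- by rewrite sa.
- by move=> j /hl <-; rewrite /= sa.
by move=> j /hr <-; rewrite /= sa.
Qed.

Local Notation x2 := (a · a).
Local Notation x3 := (a · (a · a)).
Local Notation x4 := (a · a · a).
Local Notation A := (a · x3).
Local Notation B := (a · x4).
Local Notation C := (x3 · a).

(** Compute (aa)(aa) twice: it is C by right commutativity, and x4 a - C + B by the formula for
    right multiplication by aa. *)
Lemma x4a : x4 · a = 2 *: C - B.
Proof.
have e1 : x2 · x2 = C by rewrite (mulAC nov).
have := mulr_mul nov a a x2; rewrite e1 => e2.
transitivity (C + C - B); last by module F [:: C; B].
by rewrite {1}e2; module F [:: x4 · a; C; B].
Qed.

(** The case z = aa of [heisenberg]. *)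
Lemma deg5_rel : C · a - 2 *: (B · a) + a · (x4 · a) = 0.
Proof. exact: heisenberg. Qed.

Lemma pw2_span : (P 2 <= <[x2]> + P 3)%VS.
Proof.
have h : (P 1 <= <[a]> + P 2)%VS by rewrite (generates_full ga) subvf.
have := pw_next_line (isT : 0 < 1)%N h.
by rewrite addvv.
Qed.

Lemma pw3_span : (P 3 <= <[x3]> + <[x4]> + P 4)%VS.
Proof. exact: (pw_next_line (isT : 0 < 2)%N pw2_span). Qed.

Lemma memv_x3 : x3 \in P 3.
Proof. by apply: pwMl => //; apply: memv_pw2. Qed.

Lemma memv_x4 : x4 \in P 3.
Proof. by apply: pwMr => //; apply: memv_pw2. Qed.

Lemma pw4_span : (P 4 <= <[A]> + (<[B]> + (<[C]> + P 5)))%VS.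
Proof.
set X := (X in (_ <= X)%VS).
have AX : A \in X by rewrite memvE addvSl.
have BX : B \in X by rewrite memvE (subv_trans _ (addvSr _ _)) ?addvSl.
have CX : C \in X.
  rewrite memvE (subv_trans _ (addvSr _ _)) // (subv_trans _ (addvSr _ _)) //.
  exact: addvSl.
apply: (pw_next (isT : 0 < 3)%N pw3_span); last first.
  by do 2!apply: subv_trans (addvSr _ _); exact: addvSr.
move=> w /memv_addP[_ /vlineP[c ->] [_ /vlineP[d ->] ->]].
rewrite linearDr linearDl !linearZr_LR !linearZl_LR /= x4a.
by split; apply: memvD; apply: memvZ => //; apply: memvB => //; apply: memvZ.
Qed.

Lemma dims : \dim (P 2) = 5%N /\ \dim (P 3) = 4%N.
Proof.
have h : (P 1 <= <[a]> + P 2)%VS by rewrite (generates_full ga) subvf.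
have d1 : \dim (P 1) = 6%N by [].
have := dim_pw_line h; rewrite d1 ltnS => d2.
have n1 : P 1 != 0%VS by rewrite -dimv_eq0 d1.
have := pw_dim_lt nilp (isT : 0 < 1)%N n1; rewrite d1 ltnS => d2'.
have {d2 d2'} d2 : \dim (P 2) = 5%N by apply/eqP; rewrite eqn_leq d2 d2'.
split=> //.
have := dim_pw_line pw2_span; rewrite d2 ltnS => d3.
have n2 : P 2 != 0%VS by rewrite -dimv_eq0 d2.
have := pw_dim_lt nilp (isT : 0 < 2)%N n2; rewrite d2 ltnS => d3'.
by apply/eqP; rewrite eqn_leq d3 d3'.
Qed.

End Structure.

(** * Families A and B: V^4 of dimension at most 2 *)

Section StructureB.
Variables (F : numClosedFieldType) (V : vectType F).
Variable mul : {bilinear V -> V -> V}.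
Hypotheses (dimV : \dim {:V} = 6%N).
Hypotheses (nov : novikov mul) (nilp : nilpotent mul).
Variable a : V.
Hypothesis ga : generates mul a.
Local Notation "x · y" := (mul x y) (at level 40, left associativity).
Local Notation P := (pw mul).
Implicit Types x y z : V.
Local Notation x2 := (a · a).
Local Notation x3 := (a · (a · a)).
Local Notation x4 := (a · a · a).
Local Notation A := (a · x3).
Local Notation B := (a · x4).
Local Notation C := (x3 · a).
Lemma pw0_eq0 k x : P k = 0%VS -> x \in P k -> x = 0.
Proof. by move=> ->; rewrite memv0 => /eqP. Qed.

(** Since V^5 = 0, only the linear relations between A, B, C matter: C = 0, or B is a multiple of C,
    or B and C span V^4. *)
Lemma classified_1122 : (\dim (P 4) <= 2)%N -> P 5 = 0%VS -> classified mul.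
Proof.
move=> d4 p5.
have A4 : A \in P 4 by apply: pwMl => //; apply: memv_x3.
have B4 : B \in P 4 by apply: pwMl => //; apply: memv_x4.
have C4 : C \in P 4 by apply: pwMr => //; apply: memv_x3.
have z x : x \in P 4 -> a · x = 0 /\ x · a = 0.
  by move=> h; split; apply: (pw0_eq0 p5); [apply: pwMl|apply: pwMr].
have [[aA Aa] [aB Ba]] := (z _ A4, z _ B4); have [aC Ca] := z _ C4.
have x4aE := x4a nov a.
case: (eqVneq C 0) => [C0|C0].
  apply: (classify_A1 dimV nilp).
  apply: (has_frame_words nov ga (s := [:: a; x2; x3; x4; A; B]) _ _ _
    (generated_A1 F)) => //; finish F (x4aE, aA, Aa, aB, Ba, C0) [:: x2; x3;
      x4; A; B].
case: (boolP (B \in <[C]>%VS)) => [/vlineP[l eB]|nB].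
  apply: (classify_A2 dimV nilp (l := l)).
  by apply: (has_frame_words nov ga (s := [:: a; x2; x3; x4; A; C]) _ _ _
    (generated_A2 l)) => //; finish F (x4aE, aA, Aa, aC, Ca, eB) [:: x2; x3;
      x4; A; C].
have AX : A \in (<[B]> + <[C]>)%VS.
  apply: contraT => nA; have h : (<[A]> + (<[B]> + <[C]>) <= P 4)%VS.
    by rewrite subv_add -memvE A4 subv_add -!memvE B4 C4.
  by have := leq_trans (dimvS h) d4; rewrite !dimv_add_line // dim_vline C0.
have [l h] := memv_line_add AX; have /vlineP[m {h} h] := h.
have eA : A = l *: B + m *: C by rewrite -h addrC subrK.
apply: (classify_A3 dimV nilp (l := l) (m := m)).
by apply: (has_frame_words nov ga (s := [:: a; x2; x3; x4; B; C]) _ _ _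
  (generated_A3 l m)) => //; finish F (x4aE, aB, Ba, aC, Ca, eA) [:: x2; x3;
    x4; B; C].
Qed.

(** Here V^5 is a line and V^6 = 0, so any u in V^4 outside V^5 spans V^4 modulo V^5, and a u, u a
    span V^5. The first of C, B, A outside V^5 serves as u. *)
Lemma classified_11211 : (\dim (P 4) <= 2)%N -> P 5 != 0%VS -> classified mul.
Proof.
move=> d4 n5.
have A4 : A \in P 4 by apply: pwMl => //; apply: memv_x3.
have B4 : B \in P 4 by apply: pwMl => //; apply: memv_x4.
have C4 : C \in P 4 by apply: pwMr => //; apply: memv_x3.
have n4 : P 4 != 0%VS.
  by apply: contraNneq n5 => p4; rewrite -subv0 -p4 pw_sub.
have d54 := pw_dim_lt nilp (isT : 0 < 4)%N n4.
have d65 := pw_dim_lt nilp (isT : 0 < 5)%N n5.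
have d5 : (\dim (P 5) <= 1)%N by rewrite -ltnS (leq_trans d54).
have p6 : P 6 = 0%VS.
  by apply/eqP; rewrite -dimv_eq0 -leqn0 -ltnS (leq_trans d65).
have z x : x \in P 5 -> a · x = 0 /\ x · a = 0.
  by move=> h; split; apply: (pw0_eq0 p6); [apply: pwMl|apply: pwMr].
have x4aE := x4a nov a.
have span u : u \in P 4 -> u \notin P 5 -> (P 4 <= <[u]> + P 5)%VS.
  move=> u4 u5; have h : (<[u]> + P 5 <= P 4)%VS.
    by rewrite subv_add -memvE u4 pw_sub.
  rewrite -(geq_leqif (dimv_leqif_sup h)) dimv_add_line // (leq_trans d4) //.
  by rewrite ltnS lt0n dimv_eq0.
have spanw w : (P 5 <= <[w]> + P 6)%VS ->
    forall y, y \in P 5 -> exists c, y = c *: w.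
  rewrite p6 addv0 => /subvP h y /h /vlineP[c ->]; by exists c.
have line u w c d : u \in P 4 -> u \notin P 5 -> a · u = c *: w -> u · a = d
  *: w ->
    forall y, y \in P 5 -> exists c, y = c *: w.
  move=> u4 u5 au ua; apply: spanw.
  apply: (pw_next_line1 nov ga (isT : 0 < 4)%N (span u u4 u5)).
    by rewrite au memvE (subv_trans _ (addvSl _ _)) // -memvE memvZ ?memv_line.
  by rewrite ua memvE (subv_trans _ (addvSl _ _)) // -memvE memvZ ?memv_line.
have dec u y : u \in P 4 -> u \notin P 5 -> y \in P 4 ->
    exists c, exists2 z', z' \in P 5 & y = c *: u + z'.
  move=> u4 u5 y4; have [c h] := memv_line_add (subvP (span u u4 u5) y y4).
  by exists c, (y - c *: u) => //; rewrite addrC subrK.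
have up y : y \in P 4 -> a · y \in P 5 /\ y · a \in P 5.
  by move=> h; split; [apply: pwMl|apply: pwMr].
have rel := deg5_rel nov a.
case: (boolP (C \in P 5)) => C5; last first.
  have [l [za za5 eA]] := dec _ _ C4 C5 A4.
  have [m [zb zb5 eB]] := dec _ _ C4 C5 B4.
  have [[aza zaa] [azb zba]] := (z _ za5, z _ zb5).
  (* The degree 5 relation is linear between a C and C a; its solutions are (2m - 1) w and (2 - m)
     w, and this choice of w avoids dividing by either coefficient. *)
  pose w := 1 / 3 *: (a · C + 2 *: (C · a)).
  have aC5 := proj1 (up _ C4); have Ca5 := proj2 (up _ C4).
  have w5 : w \in P 5 by apply/memvZ/memvD => //; apply: memvZ.
  have [aw wa] := z _ w5.
  have rel' : (1 - 2 * m) *: (C · a) + (2 - m) *: (a · C) = 0.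
    rewrite -rel x4aE eB !(linearDl, linearDr, linearNr, linearZl_LR,
      linearZr_LR) /=.
    by rewrite azb zba; module F [:: C · a; a · C].
  have aC : a · C = (2 * m - 1) *: w.
    transitivity ((2 * m - 1) *: w + (2 / 3) *: ((1 - 2 * m) *: (C · a) + (2 -
      m) *: (a · C))).
      by rewrite /w; module F [:: C · a; a · C].
    by rewrite rel' scaler0 addr0.
  have Ca : C · a = (2 - m) *: w.
    transitivity ((2 - m) *: w - (1 / 3) *: ((1 - 2 * m) *: (C · a) + (2 - m)
      *: (a · C))).
      by rewrite /w; module F [:: C · a; a · C].
    by rewrite rel' scaler0 subr0.
  have [p ep] := line _ _ _ _ C4 C5 aC Ca _ za5.
  have [q eq] := line _ _ _ _ C4 C5 aC Ca _ zb5.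
  rewrite {za}ep in eA aza zaa za5; rewrite {zb}eq in eB azb zba zb5.
  move: w aw wa aC Ca eA eB {rel' w5 aza zaa azb zba za5 zb5} => w aw wa aC Ca
    eA eB.
  apply: (classify_B1 dimV nilp (l := l) (m := m) (a := p) (b := q)).
  apply: (has_frame_words nov ga (s := [:: a; x2; x3; x4; C; w]) _ _ _
    (generated_B1 l m p q)) => //; finish F (x4aE, aw, wa, aC, Ca, eA, eB) [::
      x2; x3; x4; C; w].
have [aC Ca] := z _ C5.
case: (boolP (B \in P 5)) => B5; last first.
  have [p [za za5 eA]] := dec _ _ B4 B5 A4; have [aza zaa] := z _ za5.
  (* What remains of the degree 5 relation once a C = C a = 0. *)
  have aB : a · B = (- 2) *: (B · a).
    transitivity ((- 2) *: (B · a) - (C · a - 2 *: (B · a) + a · (x4 · a))).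
      by rewrite x4aE linearBr linearZr_LR /= aC Ca; module F [:: B · a; a · B].
    by rewrite rel subr0.
  have Ba : B · a = 1 *: (B · a) by rewrite scale1r.
  have [b eb] := line _ _ _ _ B4 B5 aB Ba _ za5.
  have [c eC] := line _ _ _ _ B4 B5 aB Ba _ C5.
  have [aw wa] := z _ (proj2 (up _ B4)).
  rewrite {za}eb in eA aza zaa za5.
  set w := B · a in aw wa aB Ba eA eC; have {}Ba : B · a = w by []; clearbody w.
  apply: (classify_B2 dimV nilp (p := p) (a := b) (c := c)).
  apply: (has_frame_words nov ga (s := [:: a; x2; x3; x4; B; w]) _ _ _
    (generated_B2 p b c)) => //; finish F (x4aE, aw, wa, aB, Ba, eC, eA) [::
      x2; x3; x4; B; w].
have A5 : A \notin P 5.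
  apply: contraTN d54 => A5; rewrite -leqNgt; apply: dimvS.
  apply: (subv_trans (pw4_span nov ga)).
  by rewrite subv_add -memvE A5 subv_add -memvE B5 subv_add -memvE C5 subvv.
have line1 w : w \in P 5 -> w != 0 -> forall y, y \in P 5 -> exists c, y = c
  *: w.
  by move=> w5 w0; apply: spanw; rewrite p6 addv0 vline_of_dim.
have [aA5 Aa5] := up _ A4.
case: (eqVneq (A · a) 0) => [Aa|Aa]; last first.
  have [l aA] := line1 _ Aa5 Aa _ aA5.
  have [q eB] := line1 _ Aa5 Aa _ B5; have [c eC] := line1 _ Aa5 Aa _ C5.
  have [aw wa] := z _ Aa5.
  set w := A · a in aw wa aA eB eC; have {}Aa : A · a = w by []; clearbody w.
  apply: (classify_B3 dimV nilp (q := q) (c := c) (l := l)).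
  apply: (has_frame_words nov ga (s := [:: a; x2; x3; x4; A; w]) _ _ _
    (generated_B3 q c l)) => //; finish F (x4aE, aw, wa, aA, Aa, eC, eB) [::
      x2; x3; x4; A; w].
have aA : a · A = 1 *: (a · A) by rewrite scale1r.
have Aa' : A · a = 0 *: (a · A) by rewrite Aa scale0r.
have [q eB] := line _ _ _ _ A4 A5 aA Aa' _ B5.
have [c eC] := line _ _ _ _ A4 A5 aA Aa' _ C5.
have [aw wa] := z _ aA5.
set w := a · A in aw wa eB eC; have {}aA : a · A = w by []; clearbody w.
apply: (classify_B4 dimV nilp (q := q) (c := c)).
apply: (has_frame_words nov ga (s := [:: a; x2; x3; x4; A; w]) _ _ _
  (generated_B4 q c)) => //; finish F (x4aE, aw, wa, aA, Aa, eC, eB) [:: x2;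
    x3; x4; A; w].
Qed.

End StructureB.

(** * Families D, E and I: V^3 / V^4 a line *)

Section StructureE.
Variables (F : numClosedFieldType) (V : vectType F).
Variable mul : {bilinear V -> V -> V}.
Hypotheses (dimV : \dim {:V} = 6%N).
Hypotheses (nov : novikov mul) (nilp : nilpotent mul).
Variable a : V.
Hypothesis ga : generates mul a.
Local Notation "x · y" := (mul x y) (at level 40, left associativity).
Local Notation P := (pw mul).
Implicit Types x y z : V.
Local Notation x2 := (a · a).
Local Notation x3 := (a · (a · a)).
Local Notation x4 := (a · a · a).
Local Notation A := (a · x3).
Local Notation B := (a · x4).
Local Notation C := (x3 · a).
Lemma memv_line_addI (U : {vspace V}) u c t y :
  y = c *: u + t -> t \in U -> y \in (<[u]> + U)%VS.
Proof. by move=> -> tU; apply: memv_add => //; apply/memvZ/memv_line. Qed.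

Lemma memv_lineE (U : {vspace V}) u y :
  y \in (<[u]> + U)%VS -> exists c, exists2 t, t \in U & y = c *: u + t.
Proof.
case/memv_line_add=> c h; exists c, (y - c *: u) => //.
by rewrite addrC subrK.
Qed.

Lemma pw3_dims x : (P 3 <= <[x]> + P 4)%VS -> \dim (P 4) = 3%N.
Proof.
have [_ d3] := dims dimV nov nilp ga.
move=> /dim_pw_line; rewrite d3 ltnS => h1; apply/eqP; rewrite eqn_leq h1 andbT.
have n3 : P 3 != 0%VS by rewrite -dimv_eq0 d3.
by have := pw_dim_lt nilp (isT : 0 < 3)%N n3; rewrite d3 ltnS.
Qed.

Lemma pw_dim_bound k n : (0 < k)%N -> (\dim (P k) <= n.+1)%N -> (\dim (P k.+1)
  <= n)%N.
Proof.
move=> k0 kn; case: (eqVneq (P k) 0%VS) => [e|nk].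
  by rewrite (leq_trans (dimvS (pw_sub mul k))) // e dimv0.
by rewrite -ltnS (leq_trans (pw_dim_lt nilp k0 nk)).
Qed.

(** Now A and C drop to V^5, so V^4 is spanned by u = B modulo V^5, and the dimensions are forced to
    be 6, 5, 4, 3, 2, 1. *)
Lemma classified_x3_pw4 : x3 \in P 4 -> classified mul.
Proof.
move=> x3_4.
have p3 : (P 3 <= <[x4]> + P 4)%VS.
  apply: (subv_trans (pw3_span nov ga)).
  rewrite subv_add addvSr andbT subv_add -memvE.
  by rewrite (subvP (addvSr _ _)) //= addvSl.
have d4 := pw3_dims p3.
have A5 : A \in P 5 by apply: pwMl.
have C5 : C \in P 5 by apply: pwMr.
have u4 : B \in P 4 by apply: pwMl => //; apply: memv_x4.
have x4aE := x4a nov a; have rel := deg5_rel nov a; have hei := heisenberg nov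
  a x4.
move: rel hei x4aE; set u := B in u4 * => rel hei x4aE.
have uE : B = u by [].
have p4 : (P 4 <= <[u]> + P 5)%VS.
  apply: (subv_trans (pw4_span nov ga)); rewrite subv_add -memvE.
  rewrite (subvP (addvSr _ _)) //= -/u subv_add addvSl /=.
  by rewrite subv_add addvSr andbT -memvE (subvP (addvSr _ _)).
have d5 : (2 <= \dim (P 5))%N by have := dim_pw_line p4; rewrite d4.
have d5' : (\dim (P 5) <= 2)%N by apply: pw_dim_bound; rewrite ?d4.
(* The degree 5 relation puts r in V^6, so that u a = - v and a u = 2 v modulo V^6. *)
pose v := a · u + u · a; pose r := a · u + 2 *: (u · a).
have v5 : v \in P 5 by apply: memvD; [apply: pwMl|apply: pwMr].
have rE : r = C · a + 2 *: (a · C).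
  transitivity (C · a + 2 *: (a · C) - (C · a - 2 *: (u · a) + a · (x4 · a))).
    by rewrite x4aE; expand; rewrite /r; module F [:: C · a; a · C; u · a; a ·
      u].
  by rewrite rel subr0.
have r6 : r \in P 6.
  by rewrite rE; apply: memvD; [apply: pwMr|apply/memvZ/pwMl].
have ua : u · a = - v + r by rewrite /v /r; module F [:: a · u; u · a].
have au : a · u = 2 *: v - r by rewrite /v /r; module F [:: a · u; u · a].
clearbody v r.
have p5 : (P 5 <= <[v]> + P 6)%VS.
  apply: (pw_next_line1 nov ga _ p4) => //.
    by apply: (memv_line_addI au); rewrite memvN.
  by apply: (memv_line_addI (c := - 1) (t := r)) => //; rewrite ua scaleN1r.
have d6 : (1 <= \dim (P 6))%N by rewrite -ltnS (leq_trans d5) ?(dim_pw_line p5).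
have d6' : (\dim (P 6) <= 1)%N by apply: pw_dim_bound.
have p7 : P 7 = 0%VS by apply/eqP; rewrite -dimv_eq0 -leqn0; apply:
  pw_dim_bound.
have z y : y \in P 6 -> a · y = 0 /\ y · a = 0.
  by move=> h; split; apply: (pw0_eq0 p7); [apply: pwMl|apply: pwMr].
have [ar ra] := z _ r6.
have [_ aCa] : a · (a · C) = 0 /\ a · C · a = 0 by apply: z; apply: pwMl.
have [aaC _] : a · (C · a) = 0 /\ C · a · a = 0 by apply: z; apply: pwMr.
pose w := 1 / 2 *: (a · v + v · a).
have w6 : w \in P 6 by apply/memvZ/memvD; [apply: pwMl|apply: pwMr].
have [aw wa] := z _ w6.
(* This is [heisenberg] at x4; all terms containing C or r fall into V^7 = 0. *)
have avE : a · v + 3 *: (v · a) = 0.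
  rewrite -hei x4aE; expand; rewrite aCa aaC au ua; expand; rewrite ar ra.
  by module F [:: a · v; v · a].
have va : v · a = (- 1) *: w.
  transitivity ((- 1) *: w + (1 / 2) *: (a · v + 3 *: (v · a))).
    by rewrite /w; module F [:: a · v; v · a].
  by rewrite avE scaler0 addr0.
have av : a · v = 3 *: w.
  transitivity (3 *: w - (1 / 2) *: (a · v + 3 *: (v · a))).
    by rewrite /w; module F [:: a · v; v · a].
  by rewrite avE scaler0 subr0.
clearbody w.
have p6 : (P 6 <= <[w]> + P 7)%VS.
  apply: (pw_next_line1 nov ga _ p5) => //; rewrite ?av ?va;
    exact: (memv_line_addI (esym (addr0 _)) (mem0v _)).
have [al [t t5 e3]] := memv_lineE (subvP p4 _ x3_4).
have [be [t' t6 et]] := memv_lineE (subvP p5 _ t5).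
have [g [t'' t7 et']] := memv_lineE (subvP p6 _ t6).
rewrite (pw0_eq0 p7 t7) addr0 in et'; rewrite {t'}et' in et t6; rewrite {t}et in
  e3 t5.
have eA : A = al *: (2 *: v - r) + be *: (3 *: w).
  by rewrite {1}e3; expand; rewrite au av aw; module F [:: v; r; w].
have eC : C = al *: (- v + r) + be *: ((- 1) *: w).
  by rewrite {1}e3; expand; rewrite ua va wa; module F [:: v; r; w].
have re : r = (- 5 * al) *: w.
  rewrite rE eC; expand; rewrite ar ra va av aw wa; by module F [:: w].
rewrite re in ua au eA eC.
apply: (classify_I dimV nilp (a := al) (b := be) (g := g)).
apply: (has_frame_words nov ga (s := [:: a; x2; x4; u; v; w]) _ _ _
    (generated_I al be g)) => //;
  finish F (x4aE, eC, uE, au, ua, av, va, aw, wa, e3) [:: x2; x4; u; v; w].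
Qed.

(** Comparing x4 a = 2C - B with x4 a = l C + z a and B = l A + a z gives C = l u + s. The average u
    of A and C spans V^4 modulo V^5 for every l, whereas A or C alone may fail. *)
Lemma x4_line_setup l z : x4 = l *: x3 + z -> z \in P 4 ->
  let u := 1 / 2 *: (A + C) in let s := 1 / 2 *: (a · z + z · a) in
  [/\ s \in P 5, C = l *: u + s, A = (2 - l) *: u - s, u \in P 4 &
     (P 4 <= <[u]> + P 5)%VS].
Proof.
move=> e4 z4 u s.
have x4aE := x4a nov a.
have az5 : a · z \in P 5 by apply: pwMl.
have za5 : z · a \in P 5 by apply: pwMr.
have A4 : A \in P 4 by apply: pwMl => //; apply: memv_x3.
have C4 : C \in P 4 by apply: pwMr => //; apply: memv_x3.
have s5 : s \in P 5 by apply/memvZ/memvD.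
have u4 : u \in P 4 by apply/memvZ/memvD.
have eB : B = l *: A + a · z by rewrite {1}e4; expand.
have eC : C = l *: u + s.
  transitivity (1 / 2 *: ((2 *: C - B) + B)); first by module F [:: C; B].
  rewrite -x4aE {1}e4 eB; expand.
  by rewrite /u /s; module F [:: C; A; a · z; z · a].
have eA : A = (2 - l) *: u - s.
  transitivity (2 *: u - C); first by rewrite /u; module F [:: C; A].
  by rewrite {1}eC; module F [:: u; s].
split=> //; apply: (subv_trans (pw4_span nov ga)); rewrite subv_add -memvE.
rewrite (memv_line_addI eA) ?memvN //= subv_add -memvE.
rewrite (memv_line_addI (c := l * (2 - l)) (t := a · z - l *: s)) /=; first
  last.
- by apply: memvB => //; apply: memvZ.
- by rewrite eB eA; module F [:: u; s; a · z].
by rewrite subv_add addvSr andbT -memvE (memv_line_addI eC).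
Qed.

(** The last two hypotheses make V^5 and V^6 lines modulo the next power, spanned by v and w. The
    coordinates of z on u, v, w are then the parameters of [tE]. *)
Lemma classified_x4_line_core l z : x4 = l *: x3 + z -> z \in P 4 ->
  let u := 1 / 2 *: (A + C) in let v := 1 / 3 *: (a · u + 2 *: (u · a)) in
  u · a - l *: v \in P 6 ->
  (P 7 = 0%VS -> v · a = l *: (1 / 4 *: (a · v + 3 *: (v · a)))) ->
  classified mul.
Proof.
move=> e4 z4 u v r6 k6.
have [s5 eC eA u4 p4] := x4_line_setup e4 z4.
rewrite -/u in eC eA u4 p4; set s := 1 / 2 *: _ in s5 eC eA.
have p3 : (P 3 <= <[x3]> + P 4)%VS.
  apply: (subv_trans (pw3_span nov ga)); rewrite subv_add addvSr andbT.
  by rewrite subv_add addvSl -memvE (memv_line_addI e4).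
have d4 := pw3_dims p3.
have x4aE := x4a nov a; have rel := deg5_rel nov a.
have eB : B = l *: A + a · z by rewrite {1}e4; expand.
have d5 : (2 <= \dim (P 5))%N by have := dim_pw_line p4; rewrite d4.
have d5' : (\dim (P 5) <= 2)%N by apply: pw_dim_bound; rewrite ?d4.
have v5 : v \in P 5.
  by apply/memvZ/memvD; [apply: pwMl|apply/memvZ; apply: pwMr].
have ua : u · a = l *: v + (u · a - l *: v) by module F [:: u · a; v].
have au : a · u = (3 - 2 * l) *: v - 2 *: (u · a - l *: v).
  by rewrite /v; module F [:: a · u; u · a].
move: k6; set w := 1 / 4 *: _ => k6.
have wE : a · v = 4 *: w - 3 *: (v · a) by rewrite /w; module F [:: a · v; v ·
  a].
have w6 : w \in P 6.
  by apply/memvZ/memvD; [apply: pwMl|apply/memvZ; apply: pwMr].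
have sE : s = 1 / 2 *: (a · z + z · a) by [].
move: (u · a - l *: v) r6 ua au => r r6 ua au.
clearbody s w v u.
have p5 : (P 5 <= <[v]> + P 6)%VS.
  apply: (pw_next_line1 nov ga _ p4) => //; last exact: (memv_line_addI ua).
  by apply: (memv_line_addI au); rewrite memvN; apply: memvZ.
have d6 : (1 <= \dim (P 6))%N by rewrite -ltnS (leq_trans d5) ?(dim_pw_line p5).
have d6' : (\dim (P 6) <= 1)%N by apply: pw_dim_bound.
have p7 : P 7 = 0%VS by apply/eqP; rewrite -dimv_eq0 -leqn0; apply:
  pw_dim_bound.
have zero y : y \in P 6 -> a · y = 0 /\ y · a = 0.
  by move=> h; split; apply: (pw0_eq0 p7); [apply: pwMl|apply: pwMr].
have [[ar ra] [aw wa]] := (zero _ r6, zero _ w6).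
have va := k6 p7; have av : a · v = (4 - 3 * l) *: w by rewrite wE va; module
  F [:: w].
have p6 : (P 6 <= <[w]> + P 7)%VS.
  apply: (pw_next_line1 nov ga _ p5) => //; rewrite ?av ?va;
    exact: (memv_line_addI (esym (addr0 _)) (mem0v _)).
have w0 : w != 0.
  apply: contraTneq d6 => w0; move: p6; rewrite w0 p7 addv0 => /dimvS.
  by rewrite dim_vline eqxx leqn0 => /eqP ->.
have [k [t t7 er]] := memv_lineE (subvP p6 _ r6).
rewrite (pw0_eq0 p7 t7) addr0 in er; rewrite {r r6 ar ra}er in ua au.
have [al [t1 t5 e3]] := memv_lineE (subvP p4 _ z4).
have [be [t' t6 et]] := memv_lineE (subvP p5 _ t5).
have [g [t'' t7' et']] := memv_lineE (subvP p6 _ t6).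
rewrite (pw0_eq0 p7 t7') addr0 in et'; rewrite {t' t6}et' in et; rewrite {t1 t5}et
  in e3.
have az : a · z = al *: ((3 - 2 * l) *: v - 2 *: (k *: w)) + be *: ((4 - 3 *
  l) *: w).
  by rewrite e3; expand; rewrite au av aw; module F [:: v; w].
have za : z · a = al *: (l *: v + k *: w) + be *: (l *: w).
  by rewrite e3; expand; rewrite ua va wa; module F [:: v; w].
have es : s = ((3 - l) * al / 2) *: v + (- k * al / 2 + (2 - l) * be) *: w.
  by rewrite sE az za; module F [:: v; w].
(* The degree 5 relation, read as a coefficient of the nonzero vector w. *)
have lk : l * (- k - kE l al) = 0.
  suff : (l * (- k - kE l al)) *: w = 0.
    by move/eqP; rewrite scaler_eq0 (negPf w0) orbF => /eqP.
  transitivity (1 / 3 *: (C · a - 2 *: (B · a) + a · (x4 · a))); last first.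
    by rewrite rel scaler0.
  rewrite x4aE eB; expand; rewrite eC eA es; expand.
  rewrite ?(az, za, ua, au); expand; rewrite ?(va, av, aw, wa).
  by rewrite /kE; module F [:: v; w].
apply: (classify_E dimV nilp (a := al) (b := be) (g := g) lk).
apply: (has_frame_words nov ga (s := [:: a; x2; x3; u; v; w]) _ _ _
    (generated_Ek be g lk)) => //;
  finish F (eA, eC, es, e4, e3, au, ua, av, va, aw, wa) [:: x2; x3; u; v; w].
Qed.

(** With l = 0, C lies in V^5, so A spans V^4 modulo V^5, and V^5 is spanned by a A and A a. *)
Lemma classified_11112 : x4 \in P 4 -> P 6 = 0%VS -> classified mul.
Proof.
set z := {1}x4 => z4 p6.
have e4 : x4 = 0 *: x3 + z by rewrite scale0r add0r.
have [s5 eC eA u4 p4] := x4_line_setup e4 z4; move: s5 eC eA p4.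
set s := 1 / 2 *: (a · z + z · a) => s5; rewrite scale0r add0r => eC eA p4.
have A4 : A \in P 4 by apply: pwMl => //; apply: memv_x3.
have {}p4 : (P 4 <= <[A]> + P 5)%VS.
  apply: (subv_trans p4); rewrite subv_add addvSr andbT -memvE.
  apply: (memv_line_addI (c := 1 / 2) (t := 1 / 2 *: C)).
    by module F [:: A; C].
  by apply: memvZ; rewrite eC.
have p5 := pw_next_line nov ga (isT : 0 < 4)%N p4.
rewrite p6 addv0 in p5.
have zero y : y \in P 5 -> a · y = 0 /\ y · a = 0.
  by move=> h; split; apply: (pw0_eq0 p6); [apply: pwMl|apply: pwMr].
have aA5 : a · A \in P 5 by apply: pwMl.
have Aa5 : A · a \in P 5 by apply: pwMr.
have [[aw wa] [aw' wa']] := (zero _ aA5, zero _ Aa5).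
have [al [t t5 et]] := memv_lineE (subvP p4 _ z4).
have /memv_addP[_ /vlineP[b ->] [_ /vlineP[c ->] et']] := subvP p5 _ t5.
have x4aE := x4a nov a.
have ez : x4 = al *: A + (b *: (a · A) + c *: (A · a)) by rewrite -et' -et.
have az : a · z = al *: (a · A) by rewrite et et'; expand; rewrite aw aw';
  module F [:: a · A].
have za : z · a = al *: (A · a) by rewrite et et'; expand; rewrite wa wa';
  module F [:: A · a].
rewrite /s az za in eC.
apply: (classify_D dimV nilp (a := al) (b := b) (c := c)).
apply: (has_frame_words nov ga (s := [:: a; x2; x3; A; a · A; A · a]) _ _ _
    (generated_D al b c)) => //;
  finish F (eC, ez, aw, wa, aw', wa') [:: x2; x3; A; a · A; A · a].
Qed.

(** For l = 0 the degree 5 relation does not bound u a. Instead, [heisenberg] at x3 gives (u a) a =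
    0, and a degree 6 relation excludes u a outside V^6 when V^6 is nonzero. *)
Lemma classified_x4_pw4 : x4 \in P 4 -> classified mul.
Proof.
move=> x4_4; case: (eqVneq (P 6) 0%VS) => [/classified_11112|n6]; first by apply.
have e4 : x4 = 0 *: x3 + x4 by rewrite scale0r add0r.
have [s5 eC eA u4 p4] := x4_line_setup e4 x4_4.
move: eC eA p4 (classified_x4_line_core e4 x4_4).
set u := 1 / 2 *: _ in u4 *; set s := 1 / 2 *: _ in s5 *.
rewrite scale0r add0r subr0 => eC eA p4 core; clearbody u s.
have p3 : (P 3 <= <[x3]> + P 4)%VS.
  apply: (subv_trans (pw3_span nov ga)); rewrite subv_add addvSr andbT.
  by rewrite subv_add addvSl -memvE (memv_line_addI e4).
have d4 := pw3_dims p3.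
have d5' : (\dim (P 5) <= 2)%N by apply: pw_dim_bound; rewrite ?d4.
have d6 : (1 <= \dim (P 6))%N by rewrite lt0n dimv_eq0.
have d6' : (\dim (P 6) <= 1)%N by apply: pw_dim_bound.
have p7 : P 7 = 0%VS by apply/eqP; rewrite -dimv_eq0 -leqn0; apply:
  pw_dim_bound.
have C5 : C \in P 5 by rewrite eC.
have in6 y : y \in P 5 -> a · y \in P 6 /\ y · a \in P 6.
  by move=> h; split; [apply: pwMl|apply: pwMr].
have zero y : y \in P 6 -> a · y = 0 /\ y · a = 0.
  by move=> h; split; apply: (pw0_eq0 p7); [apply: pwMl|apply: pwMr].
have [aC6 Ca6] := in6 _ C5.
have [[aaC aCa] [aaC' Caa]] := (zero _ aC6, zero _ Ca6).
have ua5 : u · a \in P 5 by apply: pwMr.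
have au5 : a · u \in P 5 by apply: pwMl.
have Caaz : C · a · a = 0 by [].
have uaa : u · a · a = 0.
  have := heisenberg nov a x3; rewrite -/C eA; expand.
  rewrite -eC aCa aaC' Caa; rewrite !scaler0 !subr0 !addr0 => /eqP.
  by rewrite scaler_eq0 pnatr_eq0 => /eqP.
(* Compute x3 x3 twice: as A (aa) by right commutativity, and by expanding right multiplication by
   a(aa). *)
have deg6 : 3 *: (a · (u · a)) - 2 *: (a · u · a) = 0.
  have rx2 y : y · x2 = (y · a) · a - (a · y) · a + a · (y · a).
    exact: mulr_mul.
  have C2 : C · x2 = 0 by rewrite rx2 Caa aCa aaC' subrr addr0.
  have Aa : A · a = 2 *: (u · a) - C · a by rewrite eA -eC; expand.
  have aA : a · A = 2 *: (a · u) - a · C by rewrite eA -eC; expand.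
  have Ax2 : A · x2 = 2 *: (a · (u · a)) - 2 *: (a · u · a).
    rewrite rx2 Aa aA; expand; rewrite uaa Caa aCa aaC'.
    by module F [:: a · (u · a); a · u · a].
  have := mulr_mul nov a x2 x3.
  rewrite -(mulAC nov a x3 x2) C2 Ax2 (rx2 x3) Aa; expand; rewrite aaC aaC' =>
    e.
  set p := a · (u · a) in e *; set q := a · u · a in e *.
  transitivity ((1 / 2) *: ((2 *: p - 2 *: q) - (0 - (2 *: p - 2 *: q) + (0 -
    (2 *: p - 0) + 0)))).
    by module F [:: p; q].
  by rewrite {1}e subrr scaler0.
have core' : u · a \in P 6 -> classified mul.
  move=> ua6; have [aua uaa'] := zero _ ua6.
  have aua0 : a · u · a = 0.
    have := deg6; rewrite aua scaler0 sub0r => /eqP.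
    by rewrite oppr_eq0 scaler_eq0 pnatr_eq0 => /eqP.
  apply: core => [|_]; first by rewrite scale0r subr0.
  by rewrite scale0r; expand; rewrite aua0 uaa; module F (@nil V).
case: (boolP (u · a \in P 6)) => [/core'//|nua].
have p5 : (P 5 <= <[u · a]> + P 6)%VS.
  have h : (<[u · a]> + P 6 <= P 5)%VS by rewrite subv_add -memvE ua5 pw_sub.
  rewrite -(geq_leqif (dimv_leqif_sup h)) dimv_add_line // (leq_trans d5') //.
have [c [t t6 eau]] := memv_lineE (subvP p5 _ au5).
have aua : a · (u · a) = 0.
  have := deg6; rewrite eau; expand; rewrite uaa (proj2 (zero _ t6)) !scaler0
    addr0 scaler0 subr0.
  by move/eqP; rewrite scaler_eq0 pnatr_eq0 => /eqP.
(* Both products of a with u a vanish although u a spans V^5 modulo V^6, so V^6 would lie in V^7 =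
   0. *)
case/negP: n6; rewrite -subv0 -p7.
apply: (subv_trans (pw_next_line nov ga (isT : 0 < 5)%N p5)).
by rewrite aua uaa subv_add subvv andbT subv_add -memvE mem0v.
Qed.

(** For nonzero l, the degree 5 relation divided by l gives u a = l v modulo V^6, and [heisenberg]
    at x3 divided by l gives v a = l w. *)
Lemma classified_x4_line l z : x4 = l *: x3 + z -> z \in P 4 -> classified mul.
Proof.
move=> e4 z4; case: (eqVneq l 0) e4 => [->|l0] e4.
  by apply: classified_x4_pw4; rewrite e4 scale0r add0r.
have [s5 eC eA u4 p4] := x4_line_setup e4 z4.
have eB : B = l *: A + a · z by rewrite {1}e4; expand.
have x4aE : x4 · a = l *: C + z · a by rewrite {1}e4; expand.
have rel := deg5_rel nov a; have hei := heisenberg nov a x3.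
move: eC eA p4 (classified_x4_line_core e4 z4).
set u := 1 / 2 *: _ in u4 *; set s := 1 / 2 *: _ in s5 *.
move=> eC eA p4 core; clearbody u s.
have u5 : a · u \in P 5 /\ u · a \in P 5 by split; [apply: pwMl|apply: pwMr].
have up y : y \in P 5 -> a · y \in P 6 /\ y · a \in P 6.
  by move=> h; split; [apply: pwMl|apply: pwMr].
have [as6 sa6] := up _ s5.
have [_ aza6] := up _ (pwMl a (isT : 0 < 4)%N z4).
have [aza6' _] := up _ (pwMr a (isT : 0 < 4)%N z4).
pose v := 1 / 3 *: (a · u + 2 *: (u · a)).
have v5 : v \in P 5 by apply/memvZ/memvD; [|apply/memvZ]; case: u5.
have r6 : u · a - l *: v \in P 6.
  have -> : u · a - l *: v = (1 / (3 * l)) *: ((1 + 2 * l) *: (s · a) -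
      2 *: (a · z · a) + (l *: (a · s) + a · (z · a))).
    transitivity ((1 / (3 * l)) *: ((1 + 2 * l) *: (s · a) -
      2 *: (a · z · a) + (l *: (a · s) + a · (z · a)) -
      (C · a - 2 *: (B · a) + a · (x4 · a)))); last by rewrite rel subr0.
    rewrite x4aE eB; expand; rewrite eC eA; expand; rewrite /v.
    by module F [:: a · u; u · a; s · a; a · z · a; a · s; a · (z · a)].
  apply/memvZ/memvD; last by apply/memvD => //; apply/memvZ.
  by apply/memvB; apply/memvZ.
apply: core => //; rewrite -/v => p7.
have zero y : y \in P 6 -> a · y = 0 /\ y · a = 0.
  by move=> h; split; apply: (pw0_eq0 p7); [apply: pwMl|apply: pwMr].
have ua : u · a = l *: v + (u · a - l *: v) by module F [:: u · a; v].
have au : a · u = (3 - 2 * l) *: v - 2 *: (u · a - l *: v).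
  by rewrite /v; module F [:: a · u; u · a].
move: (u · a - l *: v) r6 ua au => r r6 ua au; clearbody v.
have [ar ra] := zero _ r6.
have [[_ asa] [asa' saa]] := (zero _ as6, zero _ sa6).
transitivity (l *: ((1 / 4) *: (a · v + 3 *: (v · a))) - (1 / (4 * l)) *:
    (A · a · a - 2 *: (a · C · a) + a · (C · a))); last by rewrite hei scaler0
      subr0.
rewrite eC eA; expand; rewrite asa asa' saa ua au; expand; rewrite ar ra.
by module F [:: v · a; a · v].
Qed.

Lemma classified_of_generator : classified mul.
Proof.
case: (boolP (x3 \in P 4)) => [/classified_x3_pw4//|n3].
case: (boolP (x4 \in (<[x3]> + P 4)%VS)) => [/memv_lineE[l [z z4 e4]]|n4].
  exact: (classified_x4_line e4 z4).
have [_ d3] := dims dimV nov nilp ga.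
have d4 : (\dim (P 4) <= 2)%N.
  have h : (<[x4]> + (<[x3]> + P 4) <= P 3)%VS.
    by rewrite subv_add -memvE memv_x4 subv_add -memvE memv_x3 pw_sub.
  by have := dimvS h; rewrite !dimv_add_line // d3 !ltnS.
case: (eqVneq (P 5) 0%VS) => [p5|p5]; first exact: (classified_1122 dimV nov nilp ga).
exact: (classified_11211 dimV nov nilp ga).
Qed.

End StructureE.

Theorem theorem7 (R : realType) (V : vectType R[i])
    (mul : {bilinear V -> V -> V}) :
  \dim {:V} = 6%N ->
  novikov mul -> one_generated mul -> nilpotent mul ->
  exists2 t : table R[i], listed t & isomorphic mul (table_mul t).
Proof.
move=> dimV nov [a ga] nilp.
exact: (@classified_of_generator R[i] V mul dimV nov nilp a ga).
Qed.
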